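(* Let $\theta,\sigma,K>0$ and let $m^{\star}:[0,1]\to\mathbb{R}$ satisfy $|m^{\star}(t)-m^{\star}(s)|\le K|t-s|$ for all $t,s\in[0,1]$. Let $X_t=m^{\star}(t)+Y_t$, $t\in[0,1]$, where $Y$ is the stationary mean-reverting Ornstein-Uhlenbeck process with parameters $\theta,\sigma$ described in the context. Let $N\in\mathbb{N}$, $N\ge 1$, let $\alpha\in(0,1]$, and set $\beta:=1-\alpha$. Write $m^{\star}_t:=m^{\star}(t/N)$ for $t\in\{1,\dots,N\}$, and define recursively $$\hat m_1:=X_{\frac1N},\qquad \hat m_t:=(1-\alpha)\hat m_{t-1}+\alpha X_{\frac tN},\quad t\in\{2,\dots,N\}.$$ Then $\mathbb{E}[|\hat m_1-m^{\star}_1|^2]=\frac{\sigma^2}{2\theta}$. Moreover, if $N\ge 2$ and $\beta\neq e^{-\theta/N}$, then $$\begin{aligned}\mathbb{E}[|\hat m_N-m^{\star}_N|^2]\le{}&\beta^{2(N-1)}\frac{\sigma^2}{2\theta}+\left(\beta^2\frac{1+\beta}{1-\beta}\frac{K^2}{N^2}+\alpha^2\frac{\sigma^2}{2\theta}\frac{e^{\frac{\theta}{N}}+\beta}{e^{\frac{\theta}{N}}-\beta}\right)\frac{1-\beta^{2(N-1)}}{1-\beta^2}\\&+2\frac{K^2}{N^2}\frac{\beta^{2N}-\beta^{N+1}}{\alpha^2}+\alpha\frac{\sigma^2}{\theta}\,\frac{e^{\frac{\theta}{N}}-1}{1-\beta e^{-\frac{\theta}{N}}}\,\frac{\beta^{2N-1}e^{-\frac{\theta}{N}}-\beta^{N}e^{-\theta}}{\beta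 e^{\frac{\theta}{N}}-1}.\end{aligned}$$ Furthermore, this inequality is sharp: if $m^{\star}$ is linear with Lipschitz constant exactly $K$, i.e. $m^{\star}(t)=a+bt$ for all $t\in[0,1]$ with $a,b\in\mathbb{R}$ and $|b|=K$, then it is an equality.
   Context: The process $\{Y_t\}_{t\ge0}$ is the solution of the stochastic differential equation $dY_t=-\theta Y_t\,dt+\sigma\,dB_t$, $t>0$, where $\{B_t\}_{t\ge 0}$ is a standard one-dimensional Brownian motion and the initial condition $Y_0$ is Gaussian with mean $0$ and variance $\frac{\sigma^2}{2\theta}$ and is independent of $\{B_t\}_{t\ge0}$. Consequently, for all $t,s\in\{1,\dots,N\}$, $X_{t/N}$ is Gaussian with mean $m^{\star}_t$ and variance $\frac{\sigma^2}{2\theta}$, and $\mathrm{cov}(X_{t/N},X_{s/N})=\frac{\sigma^2}{2\theta}e^{-\frac{\theta}{N}|t-s|}$. The function $m^{\star}$ is deterministic. *)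

(* Defs.v *)
From HB Require Import structures.
From mathcomp Require Export all_boot all_order all_algebra.
From mathcomp Require Export all_classical all_reals all_analysis.

Set Implicit Arguments.
Unset Strict Implicit.
Unset Printing Implicit Defensive.

Export Order.TTheory GRing.Theory Num.Theory.
Export numFieldNormedType.Exports.

Local Open Scope classical_set_scope.
Local Open Scope ring_scope.

(* [normal_prob] is parameterized by the standard deviation, hence the
   square root of the variance [v]. *)
Definition gaussian (d : measure_display) (T : measurableType d)
    (R : realType) (P : probability T R) (X : T -> R) (mean v : R) : Prop :=
  forall A : set R, measurable A ->
    P (X @^-1` A) = normal_prob mean (Num.sqrt v) A.

Definition independent_family (d : measure_display) (T : measurableType d)
    (R : realType) (P : probability T R) (n : nat) (X : 'I_n -> T -> R) : Prop :=
  forall A : 'I_n -> set R, (forall i, measurable (A i)) ->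
    P (\bigcap_i (X i @^-1` A i)) = (\prod_(i < n) P (X i @^-1` A i))%E.

(* Processes indexed by the half-line [0, +oo[ are represented as functions on
   R; their values at negative times play no role. *)

Definition sigma_process (d : measure_display) (T : measurableType d)
    (R : realType) (B : R -> T -> R) : set (set T) :=
  <<s [set E | exists (t : R) (A : set R),
         [/\ 0 <= t, measurable A & E = B t @^-1` A]] >>.

Definition independent_of_process (d : measure_display) (T : measurableType d)
    (R : realType) (P : probability T R) (X : T -> R) (B : R -> T -> R) : Prop :=
  forall (A : set R) (E : set T), measurable A -> sigma_process B E ->
    P (X @^-1` A `&` E) = (P (X @^-1` A) * P E)%E.

Record brownian_motion (d : measure_display) (T : measurableType d)
    (R : realType) (P : probability T R) (B : R -> {RV P >-> R}) : Prop :=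
  BrownianMotion {
    brownian_start : {ae P, forall w, B 0 w = 0};
    brownian_indep : forall (n : nat) (t : nat -> R),
      0 <= t 0%N -> (forall i, (i < n)%N -> t i <= t i.+1) ->
      independent_family P (fun (i : 'I_n) w => B (t i.+1) w - B (t i) w);
    brownian_gaussian : forall s t : R, 0 <= s -> s < t ->
      gaussian P (fun w => B t w - B s w) 0 (t - s);
    brownian_continuous :
      {ae P, forall w, {within `[0, +oo[, continuous (fun t => B t w)}}
  }.

(* dY_t = - theta Y_t dt + sigma dB_t in integral form.  The diffusion
   coefficient is constant, so that the stochastic integral of sigma over
   [0, t] is sigma (B_t - B_0) and the equation makes sense pathwise. *)
Definition ou_sde (d : measure_display) (T : measurableType d)
    (R : realType) (P : probability T R) (theta sigma : R)
    (B Y : R -> {RV P >-> R}) : Prop :=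
  {ae P, forall w,
    {within `[0, +oo[, continuous (fun t => Y t w)} /\
    forall t : R, 0 <= t ->
      Y t w = Y 0 w + (\int[lebesgue_measure]_(s in `[0, t]) (- theta * Y s w))
              + sigma * (B t w - B 0 w)}.

Record stationary_ou (d : measure_display) (T : measurableType d)
    (R : realType) (P : probability T R) (theta sigma : R)
    (B Y : R -> {RV P >-> R}) : Prop :=
  StationaryOU {
    ou_noise : brownian_motion B;
    ou_init : gaussian P (Y 0) 0 (sigma ^+ 2 / (2 * theta));
    ou_init_indep : independent_of_process P (Y 0) B;
    ou_equation : ou_sde theta sigma B Y
  }.

(* Main.v *)
Require Import Defs.
From mathcomp Require Import measurable_realfun ring.

(** The moving average is linear in its inputs, so its error at time [N] splits
as a deterministic bias, the error of the moving average applied to [m]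
itself, plus the moving average [Z] of the noise [Y].  As [Y] is centred, the
mean squared error is the variance of [Z] plus the square of the bias.

The bias obeys [D_t = beta D_(t-1) - beta (m_t - m_(t-1))]; the Lipschitz bound
turns this into a geometric sum, and constant increments of [m] make the
estimate an identity, which is where sharpness comes from.  The variance
of [Z] follows from a linear recursion as soon as
[cov(Y_s, Y_t) = sigma^2/(2 theta) exp(-theta |t - s|)]; the two geometric
ratios [beta^2] and [beta rho], with [rho = exp(-theta/N)], meet in the last
summand of the bound, where [beta <> rho] keeps them apart
([ema_covariance], [ema_variance], [ema_bias_le], [ema_bias_linear]).

The substance of the proof is the covariance of [Y], to be extracted from the
pathwise equation without stochastic integration.  On a mesh [h], consider
the exponential scheme
[y_(k+1) = exp(-theta h) (y_k + sigma (B_((k+1)h) - B_(kh)))], [y_0 = Y_0].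
It is a finite combination of [Y_0] and Brownian increments, which are
pairwise orthogonal in L2, so its second moments are explicit; they converge to
the stationary ones ([scheme_variance], [scheme_covariance]).

Two facts carry these moments over to [Y].  Path by path, the scheme converges
to [Y] as the mesh shrinks, because paths are uniformly continuous on compact
intervals ([scheme_pathwise_cvg]).  In L2, at a fixed time, refining a mesh [h] moves
the scheme by [O(h)] uniformly in the refinement ([scheme_refinement]).  Letting the
refinement go to infinity, Fatou's lemma bounds the L2 distance from [Y] to
the scheme of mesh [h] by the same [O(h)] ([L2_fatou]); pathwise convergence is
thus upgraded to L2 convergence, and covariances pass to the limit
([stationary_ou_covariance]).

Orthogonality of the increments uses that independent square integrable
variables satisfy [E[XY] = E[X] E[Y]], an instance of Fubini for the product of
their laws ([dotL2_independent]), and the first two moments of the centred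
normal law ([gaussian_centered_moments]). *)

Set Implicit Arguments.
Unset Strict Implicit.
Unset Printing Implicit Defensive.

Local Open Scope classical_set_scope.
Local Open Scope ring_scope.

(** * Integrals against the normal density *)

(** A density is a version of the Radon-Nikodym derivative, for which the change of
variables is known; uniqueness up to null sets transfers it to [g]. *)
Lemma ge0_integral_density (d : measure_display) (T : measurableType d)
    (R : realType) (nu : {finite_measure set T -> \bar R})
    (mu : {sigma_finite_measure set T -> \bar R}) (g f : T -> \bar R) :
  measurable_fun [set: T] g ->
  (forall A, measurable A -> nu A = \int[mu]_(x in A) g x)%E ->
  measurable_fun [set: T] f -> (forall x, 0 <= f x)%E ->
  (\int[nu]_x f x = \int[mu]_x (f x * g x))%E.
Proof.
move=> mg nug mf f0.
have numu : nu `<< mu.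
  apply/null_content_dominatesP => A mA muA0; rewrite nug//.
  by apply: null_set_integral => //; exact: measurable_funTS.
have mh := measurable_int _ (Radon_Nikodym_SigmaFinite.f_integrable numu).
rewrite -(Radon_Nikodym_SigmaFinite.change_of_variables numu)//.
apply: ae_eq_integral => //; [exact: emeasurable_funM..|].
apply: ae_eqe_mul2l; apply: integral_ae_eq => //.
  exact: Radon_Nikodym_SigmaFinite.f_integrable.
by move=> E _ mE; rewrite -nug// -Radon_Nikodym_SigmaFinite.f_integral.
Qed.

Lemma ge0_integral_reflection (R : realType) (f : R -> \bar R) :
  measurable_fun [set: R] f -> (forall x, 0 <= f x)%E ->
  (\int[lebesgue_measure]_x f x = \int[lebesgue_measure]_x f (- x)%R)%E.
Proof.
move=> mf f0.
rewrite -[RHS](@ge0_integral_pushforward _ _ (measurableTypeR R) (measurableTypeR R) R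
  -%R _ lebesgue_measure setT)//.
by apply: eq_measure_integral => A mA _; exact/esym/lebesgue_measureN.
Qed.

(** Integration by parts: [F x = - s^2 x g x], with [g] the density, is a primitive of
[x^2 g - s^2 g] vanishing at [0] and at infinity, so that [x^2 g] and [s^2 g]
have the same integral over the half-line.  The half-line is cut at [s], where
the difference changes sign, so that every integral involved is that of a
nonnegative function. *)
Lemma integral_sqr_normal_pdf (R : realType) (s : R) : 0 < s ->
  (\int[lebesgue_measure]_x (x ^+ 2 * normal_pdf 0 s x)%:E = (s ^+ 2)%:E)%E.
Proof.
move=> s0; have sn0 : s != 0 by rewrite gt_eqF.
set g := normal_pdf 0 s; set mu := lebesgue_measure.
have gE x : g x = normal_peak s * expR (- x ^+ 2 / (s ^+ 2 *+ 2)).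
  by rewrite /g normal_pdfE// /normal_fun subr0.
have g0 x : 0 <= g x by exact: normal_pdf_ge0.
have gD (x : R) : is_derive x 1 (fun y => - s ^+ 2 * y * g y)
    (x ^+ 2 * g x - s ^+ 2 * g x).
  rewrite (_ : (fun y => _) = (fun y => - s ^+ 2 * y *
      (normal_peak s * expR (- y ^+ 2 / (s ^+ 2 *+ 2))))); last first.
    by apply/funext => y; rewrite gE.
  apply: is_derive_eq.
  rewrite !gE /GRing.scale /=.
  field.
  by rewrite sn0.
have cg : continuous g by exact: continuous_normal_pdf.
have cA : continuous (fun x : R => x ^+ 2 * g x).
  by move=> x; apply: cvgM; [exact: exprn_continuous | exact: cg].
have cB : continuous (fun x : R => s ^+ 2 * g x).
  by move=> x; apply: cvgM; [exact: cvg_cst | exact: cg].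
have A0 x : 0 <= x ^+ 2 * g x by rewrite mulr_ge0 ?sqr_ge0.
have B0 x : 0 <= s ^+ 2 * g x by rewrite mulr_ge0 ?sqr_ge0.
have mcont (D : set R) (f : R -> R) : continuous f -> measurable_fun D (EFin \o f).
  move=> cf; apply/measurable_EFinP/measurable_funTS.
  exact: continuous_measurable_fun.
pose F (x : R) : R := - s ^+ 2 * x * g x.
have F'E : F^`()%classic =1 (fun x => x ^+ 2 * g x - s ^+ 2 * g x).
  by move=> x; rewrite derive1E; have [] := gD x.
have dF (x : R) : derivable F x 1 by case: (gD x).
have cF : continuous F.
  by move=> x; apply: differentiable_continuous; apply/derivable1_diffP.
have Fy : F x @[x --> +oo] --> (0 : R).
  apply/cvgrPdist_le => e e0; near=> x.
  have x0 : 0 < x by near: x; exact: nbhs_pinfty_gt.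
  set c := s ^+ 2 * normal_peak s * (s ^+ 2 *+ 2).
  have c0 : 0 <= c.
    apply: mulr_ge0; last by rewrite mulrn_wge0// sqr_ge0.
    by apply: mulr_ge0; [exact: sqr_ge0 | exact: normal_peak_ge0].
  have xe : c / e <= x by near: x; apply: nbhs_pinfty_ge; rewrite num_real.
  have u0 : 0 < x ^+ 2 / (s ^+ 2 *+ 2).
    by apply: divr_gt0; rewrite ?mulrn_wgt0// exprn_gt0.
  rewrite sub0r normrN /F gE !normrM normrN !ger0_norm
    ?normal_peak_ge0 ?expR_ge0 ?sqr_ge0 ?(ltW x0)//.
  rewrite mulNr expRN.
  apply: (@le_trans _ _ (s ^+ 2 * x * (normal_peak s * (x ^+ 2 / (s ^+ 2 *+ 2))^-1))).
    apply: ler_wpM2l; first by apply: mulr_ge0; [exact: sqr_ge0 | exact: ltW].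
    apply: ler_wpM2l; first exact: normal_peak_ge0.
    rewrite lef_pV2 ?posrE ?expR_gt0//.
    by apply: le_trans (expR_ge1Dx _); rewrite lerDr.
  rewrite (_ : _ * _ = c / x); last by rewrite /c; field; rewrite sn0 gt_eqF.
  by rewrite ler_pdivrMr// -ler_pdivrMl// mulrC.
have lower : (\int[mu]_(x in `[0%R, s]) (s ^+ 2 * g x)%:E =
  \int[mu]_(x in `[0%R, s]) (x ^+ 2 * g x)%:E + (- F s)%:E)%E.
  have <- : (\int[mu]_(x in `[0%R, s]) (s ^+ 2 * g x - x ^+ 2 * g x)%:E = (- F s)%:E)%E.
    rewrite (@continuous_FTC2 _ _ (fun x => - F x))//.
    - by rewrite /F mulr0 mul0r oppr0 sube0.
    - apply: continuous_subspaceT => x.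
      by apply: cvgB; [exact: cB | exact: cA].
    - split.
      + by move=> x _; apply: derivableN; exact: dF.
      + by apply: cvg_at_right_filter; apply: cvgN; exact: cF.
      + by apply: cvg_at_left_filter; apply: cvgN; exact: cF.
    - move=> x _; rewrite derive1N; last exact: dF.
      by rewrite F'E opprB.
  rewrite -ge0_integralD//=.
  - by apply: eq_integral => x _; rewrite -EFinD addrC subrK.
  - by move=> x _; rewrite lee_fin.
  - exact: mcont.
  - move=> x; rewrite in_itv/= => /andP[x0 xs].
    by rewrite lee_fin -mulrBl mulr_ge0// subr_ge0 lerXn2r ?nnegrE// ltW.
  - apply: mcont => x.
    by apply: cvgB; [exact: cB | exact: cA].
have upper : (\int[mu]_(x in `[s, +oo[) (x ^+ 2 * g x)%:E =
  \int[mu]_(x in `[s, +oo[) (s ^+ 2 * g x)%:E + (- F s)%:E)%E.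
  have <- : (\int[mu]_(x in `[s, +oo[) (x ^+ 2 * g x - s ^+ 2 * g x)%:E = (- F s)%:E)%E.
    rewrite (@ge0_continuous_FTC2y _ _ F s 0)//.
    - by rewrite sub0e.
    - move=> x sx; rewrite -mulrBl mulr_ge0// subr_ge0 lerXn2r ?nnegrE ?(ltW s0)//.
      by rewrite (le_trans (ltW s0)).
    - apply: continuous_subspaceT => x.
      by apply: cvgB; [exact: cA | exact: cB].
    - by apply: cvg_at_right_filter; exact: cF.
  rewrite -ge0_integralD//=.
  - by apply: eq_integral => x _; rewrite -EFinD addrC subrK.
  - by move=> x _; rewrite lee_fin.
  - exact: mcont.
  - move=> x; rewrite in_itv/= andbT => sx.
    rewrite lee_fin -mulrBl mulr_ge0// subr_ge0 lerXn2r ?nnegrE ?(ltW s0)//.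
    by rewrite (le_trans (ltW s0)).
  - apply: mcont => x.
    by apply: cvgB; [exact: cA | exact: cB].
have half (f : R -> R) : continuous f -> (forall x, 0 <= f x) ->
  (\int[mu]_(x in [set x | (0 <= x)%R]) (f x)%:E =
   \int[mu]_(x in `[0%R, s]) (f x)%:E + \int[mu]_(x in `[s, +oo[) (f x)%:E)%E.
  move=> cf f0; rewrite -set_itvcy.
  rewrite (@itv_bndbnd_setU _ _ (BLeft 0) (BRight s) +oo%O)/= ?bnd_simp ?(ltW s0)//.
  rewrite ge0_integral_setU//=.
  - congr (_ + _)%E; rewrite integral_itv_obnd_cbnd//.
    exact: mcont.
  - exact: mcont.
  - by move=> x _; rewrite lee_fin.
  - apply/disj_setPS => x; rewrite /= !in_itv/= andbT => -[/andP[_ xs] sx].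
    by have := lt_le_trans sx xs; rewrite ltxx.
rewrite ge0_symfun_integralT//; last by move=> x /=; rewrite !gE sqrrN.
rewrite half// upper addeCA -lower addeC -half//.
rewrite -ge0_symfun_integralT//; last by move=> x /=; rewrite !gE sqrrN.
under eq_integral do rewrite EFinM.
rewrite ge0_integralZl//.
- by rewrite integral_normal_pdf mule1.
- by apply: mcont; exact: cg.
- by move=> x _; rewrite lee_fin.
- by rewrite lee_fin sqr_ge0.
Unshelve. all: end_near. Qed.

(** * The inner product of square integrable random variables *)

Definition dotL2 (d : measure_display) (T : measurableType d) (R : realType)
    (P : probability T R) (X Y : T -> R) : R :=
  fine 'E_P[fun w => (X w * Y w)%R]%E.

Lemma cvg_bounded_dist (R : realType) (u v : nat -> R) (l : R) :
  (forall n, `|u n - l| <= v n) -> v n @[n --> \oo] --> 0 ->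
  u n @[n --> \oo] --> l.
Proof.
move=> uv v0; apply/cvgrPdist_le => e e0.
move/cvgr0_norm_le/(_ e e0): v0; apply: filterS => n vn.
by rewrite distrC (le_trans (uv n))// (le_trans (ler_norm _)).
Qed.

Section dotL2.
Context {d : measure_display} {T : measurableType d} {R : realType}.
Variable P : probability T R.
Implicit Types X Y Z : T -> R.
Local Notation L2 := (Lfun P 2%:E).
Local Notation dot := (dotL2 P).

Lemma L2_measurable X : X \in L2 -> measurable_fun [set: T] X.
Proof. by rewrite inE => /andP[]; rewrite inE. Qed.

Lemma L2_cst c : cst c \in L2.
Proof. exact: Lfun_cst. Qed.

Lemma L2_lin a X Y : X \in L2 -> Y \in L2 -> a *: X + Y \in L2.
Proof.
have [_ cl] := @Lfun_submod_closed _ T R P 2%:E (lee1n 2).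
exact: cl.
Qed.

Lemma L2D X Y : X \in L2 -> Y \in L2 -> X + Y \in L2.
Proof. by move=> hX hY; rewrite -[X]scale1r; exact: L2_lin. Qed.

Lemma L2Z a X : X \in L2 -> a *: X \in L2.
Proof. by move=> hX; rewrite -[_ *: _]addr0; apply: L2_lin => //; exact: L2_cst. Qed.

Lemma L2B X Y : X \in L2 -> Y \in L2 -> X - Y \in L2.
Proof. by move=> hX hY; rewrite addrC -scaleN1r; exact: L2_lin. Qed.

Lemma L2_sum (n : nat) (F : nat -> T -> R) : (forall i, F i \in L2) ->
  \sum_(i < n) F i \in L2.
Proof.
move=> hF; elim: n => [|n IH]; first by rewrite big_ord0; exact: L2_cst.
by rewrite big_ord_recr; exact: L2D.
Qed.

Lemma L2_sqr_lty X : measurable_fun [set: T] X ->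
  (\int[P]_w (X w ^+ 2)%:E < +oo)%E -> X \in L2.
Proof.
move=> mX fX; rewrite inE; apply/andP; split; rewrite inE//=.
rewrite /finite_norm unlock /Lnorm; apply: poweR_lty.
apply: le_lt_trans fX; rewrite le_eqVlt; apply/orP; left; apply/eqP.
by apply: eq_integral => w _ /=; rewrite powR_mulrn// real_normK// num_real.
Qed.

Lemma L2_mul_L1 X Y : X \in L2 -> Y \in L2 -> (fun w => X w * Y w) \in Lfun P 1.
Proof. by move=> hX hY; exact: Lfun2_mul_Lfun1. Qed.

Lemma dotL2_expectation X Y : X \in L2 -> Y \in L2 ->
  ('E_P[fun w => (X w * Y w)%R] = (dot X Y)%:E)%E.
Proof. by move=> hX hY; rewrite fineK// expectation_fin_num// L2_mul_L1. Qed.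

Lemma expectation_sqr X : X \in L2 ->
  ('E_P[fun w => (`|X w| ^+ 2)%R] = (dot X X)%:E)%E.
Proof.
move=> hX; rewrite -dotL2_expectation//; congr expectation.
by apply/funext => w; rewrite real_normK ?num_real// expr2.
Qed.

Lemma dotL2C X Y : dot X Y = dot Y X.
Proof. by rewrite /dotL2; congr (fine 'E_P[_]%E); apply/funext => w; rewrite mulrC. Qed.

Lemma dotL2_linl a X Y Z : X \in L2 -> Y \in L2 -> Z \in L2 ->
  dot (a *: X + Y) Z = a * dot X Z + dot Y Z.
Proof.
move=> hX hY hZ; apply: EFin_inj.
rewrite EFinD EFinM -!dotL2_expectation//; last exact: L2_lin.
rewrite -expectationZl ?(L2_mul_L1 hX hZ)// -expectationD ?(L2_mul_L1 hY hZ)//; last first.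
  exact: (@Lfun_scale _ _ _ P (fun w => X w * Z w) a 1 (lexx 1) (L2_mul_L1 hX hZ)).
congr expectation; apply/funext => w.
by rewrite /= !fctE /= /GRing.scale /=; ring.
Qed.

Lemma dotL2Dl X Y Z : X \in L2 -> Y \in L2 -> Z \in L2 ->
  dot (X + Y) Z = dot X Z + dot Y Z.
Proof. by move=> *; rewrite -[X in LHS]scale1r dotL2_linl// mul1r. Qed.

Lemma dotL2_0l Z : dot (cst 0) Z = 0.
Proof.
rewrite /dotL2 (_ : (fun w => _) = cst 0) ?expectation_cst//.
by apply/funext => w /=; rewrite mul0r.
Qed.

Lemma dotL2Zl a X Z : X \in L2 -> Z \in L2 -> dot (a *: X) Z = a * dot X Z.
Proof.
move=> hX hZ; rewrite -[_ *: _]addr0 dotL2_linl//; last exact: L2_cst.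
by have -> : dot 0 Z = 0 := dotL2_0l Z; rewrite addr0.
Qed.

Lemma dotL2Dr X Y Z : X \in L2 -> Y \in L2 -> Z \in L2 ->
  dot Z (X + Y) = dot Z X + dot Z Y.
Proof. by move=> *; rewrite dotL2C dotL2Dl// ![dot _ Z]dotL2C. Qed.

Lemma dotL2Zr a X Z : X \in L2 -> Z \in L2 -> dot Z (a *: X) = a * dot Z X.
Proof. by move=> *; rewrite dotL2C dotL2Zl// dotL2C. Qed.

Lemma dotL2Bl X Y Z : X \in L2 -> Y \in L2 -> Z \in L2 ->
  dot (X - Y) Z = dot X Z - dot Y Z.
Proof.
by move=> *; rewrite addrC -scaleN1r dotL2_linl// mulN1r addrC.
Qed.

Lemma dotL2Br X Y Z : X \in L2 -> Y \in L2 -> Z \in L2 ->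
  dot Z (X - Y) = dot Z X - dot Z Y.
Proof. by move=> *; rewrite dotL2C dotL2Bl// ![dot _ Z]dotL2C. Qed.

Lemma dotL2_sumr (n : nat) (F : nat -> T -> R) Z :
  (forall i, F i \in L2) -> Z \in L2 ->
  dot Z (\sum_(i < n) F i) = \sum_(i < n) dot Z (F i).
Proof.
move=> hF hZ; elim: n => [|n IH].
  by rewrite !big_ord0 dotL2C; exact: dotL2_0l.
by rewrite !big_ord_recr/= dotL2Dr ?IH//; exact: L2_sum.
Qed.

Lemma dotL2_ge0 X : 0 <= dot X X.
Proof.
by apply: fine_ge0; apply: expectation_ge0 => w; rewrite -expr2 sqr_ge0.
Qed.

Lemma dotL2_sqrD X Y : X \in L2 -> Y \in L2 ->
  dot (X + Y) (X + Y) = dot X X + 2 * dot X Y + dot Y Y.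
Proof.
move=> hX hY; have hXY := L2D hX hY.
by rewrite dotL2Dl// !dotL2Dr// (dotL2C Y X); ring.
Qed.

(** The quadratic polynomial [t |-> |X + t Y|^2] is nonnegative; it is evaluated at
its minimum when [|Y| > 0], and far enough along the line where it is affine
otherwise. *)
Lemma dotL2_CauchySchwarz X Y : X \in L2 -> Y \in L2 ->
  dot X Y ^+ 2 <= dot X X * dot Y Y.
Proof.
move=> hX hY.
have q t : 0 <= dot X X + 2 * t * dot X Y + t ^+ 2 * dot Y Y.
  have := dotL2_ge0 (X + t *: Y).
  rewrite dotL2_sqrD//; last exact: L2Z.
  rewrite !dotL2Zr ?L2Z// dotL2Zl// => /le_trans; apply.
  by rewrite le_eqVlt; apply/orP; left; apply/eqP; ring.
have a0 := dotL2_ge0 X; have := dotL2_ge0 Y; rewrite le_eqVlt => /predU1P[c0|c0].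
  move: q; rewrite -c0 mulr0 => q.
  have [->|b0] := eqVneq (dot X Y) 0; first by rewrite expr0n.
  have := q (- (dot X X + 1) / (2 * dot X Y)).
  rewrite (_ : _ + _ = -1); last by field.
  by rewrite ler0N1.
have := q (- dot X Y / dot Y Y).
rewrite (_ : _ + _ = (dot X X * dot Y Y - dot X Y ^+ 2) / dot Y Y); last first.
  by field; rewrite gt_eqF.
by rewrite pmulr_lge0 ?invr_gt0// subr_ge0.
Qed.

Lemma normr_dotL2_le X Y : X \in L2 -> Y \in L2 ->
  `|dot X Y| <= Num.sqrt (dot X X) * Num.sqrt (dot Y Y).
Proof.
move=> hX hY; rewrite -sqrtr_sqr -sqrtrM ?dotL2_ge0// ler_sqrt.
  exact: dotL2_CauchySchwarz.
by rewrite mulr_ge0 ?dotL2_ge0.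
Qed.

Lemma dotL2_cvg (x y : nat -> T -> R) X Y :
  (forall n, x n \in L2) -> (forall n, y n \in L2) -> X \in L2 -> Y \in L2 ->
  dot (X - x n) (X - x n) @[n --> \oo] --> 0 ->
  dot (Y - y n) (Y - y n) @[n --> \oo] --> 0 ->
  dot (x n) (y n) @[n --> \oo] --> dot X Y.
Proof.
move=> hx hy hX hY cx cy.
have sq (u : nat -> R) : u n @[n --> \oo] --> 0 ->
    Num.sqrt (u n) @[n --> \oo] --> 0.
  move=> cu; rewrite -[X in _ --> X]sqrtr0.
  by apply: continuous_cvg => //; exact: sqrt_continuous.
have hxX n : X - x n \in L2 by exact: L2B.
have hyY n : Y - y n \in L2 by exact: L2B.
set a := fun n => Num.sqrt (dot (X - x n) (X - x n)).
set b := fun n => Num.sqrt (dot (Y - y n) (Y - y n)).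
set A := Num.sqrt (dot X X); set B := Num.sqrt (dot Y Y).
apply: (@cvg_bounded_dist _ _ (fun n => a n * b n + a n * B + A * b n)).
- move=> n.
  rewrite (_ : _ - _ =
      dot (X - x n) (Y - y n) - dot (X - x n) Y - dot X (Y - y n)).
    apply: le_trans (ler_normB _ _) _; apply: lerD; last exact: normr_dotL2_le.
    apply: le_trans (ler_normB _ _) _.
    by apply: lerD; exact: normr_dotL2_le.
  by rewrite !dotL2Bl// !dotL2Br//; ring.
- rewrite [X in _ --> X](_ : 0 = 0 * 0 + 0 * B + A * 0); last by ring.
  by apply: cvgD; [apply: cvgD|]; apply: cvgM; (exact: cvg_cst || exact: sq).
Qed.

(** Almost sure convergence and a uniform L2 bound place the limit in L2, with the
same bound.  Applied to differences, this turns a Cauchy estimate in L2 along an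
almost surely convergent sequence into an L2 rate of convergence. *)
Lemma L2_fatou (x : nat -> T -> R) X (c : R) :
  (forall n, x n \in L2) -> measurable_fun [set: T] X ->
  {ae P, forall w, x n w @[n --> \oo] --> X w} ->
  (forall n, dot (x n) (x n) <= c) ->
  X \in L2 /\ dot X X <= c.
Proof.
move=> hx mX cvx dc.
have mx n := L2_measurable (hx n).
have key : (\int[P]_w (X w ^+ 2)%:E <= c%:E)%E.
  rewrite (_ : (\int[P]_w _)%E =
      (\int[P]_w limn_einf (fun n => (x n w ^+ 2)%:E))%E); last first.
    apply: ae_eq_integral => //.
    - by apply/measurable_EFinP; exact: measurable_funX.
    - rewrite (_ : (fun w => _) =
          (fun w => - limn_esup (fun n => - (x n w ^+ 2)%:E))%E); last first.
        apply/funext => w; rewrite -limn_einfN; congr limn_einf.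
        by apply/funext => n /=; rewrite opprK.
      apply: measurableT_comp => //; apply: measurable_fun_limn_esup => n.
      apply: measurableT_comp => //.
      by apply/measurable_EFinP; exact: measurable_funX.
    - apply: filterS cvx => w cw _.
      have : (x n w ^+ 2)%:E @[n --> \oo] --> (X w ^+ 2)%:E.
        apply: cvg_EFin; first exact: nearW.
        by rewrite /comp/=; apply: cvgM; exact: cw.
      by move=> /cvg_limn_einf_sup[-> _].
  apply: le_trans (fatou _ _ _ _) _ => //.
  - by move=> n; apply/measurable_EFinP; exact: measurable_funX.
  - by move=> n w _; rewrite lee_fin sqr_ge0.
  rewrite limn_einf_lim; apply: lime_le; first exact: is_cvg_einfs.
  apply: nearW => n; apply: le_trans (ereal_inf_lbound _) _.
    by exists n => /=.
  rewrite (_ : (\int[P]_w _)%E = (dot (x n) (x n))%:E) ?lee_fin//.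
  rewrite -dotL2_expectation// unlock.
  by apply: eq_integral => w _; rewrite expr2.
have hX : X \in L2 by apply: L2_sqr_lty => //; exact: le_lt_trans key (ltry _).
split => //; rewrite -lee_fin -dotL2_expectation//; move: key.
by rewrite unlock; under eq_integral do rewrite expr2.
Qed.

End dotL2.

(** * Centred Gaussian variables and independence *)

Section gaussian.
Context {d : measure_display} {T : measurableType d} {R : realType}.
Variable P : probability T R.
Local Notation L2 := (Lfun P 2%:E).
Local Notation dot := (dotL2 P).

Lemma gaussian_ge0_integral (X : T -> R) (mean v : R) (f : R -> R) :
  measurable_fun [set: T] X -> gaussian P X mean v ->
  measurable_fun [set: R] f -> (forall x, 0 <= f x) ->
  (\int[P]_w (f (X w))%:E =
   \int[lebesgue_measure]_x (f x * normal_pdf mean (Num.sqrt v) x)%:E)%E.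
Proof.
move=> mX gX mf f0.
have mEf : measurable_fun [set: measurableTypeR R] (EFin \o f) by exact/measurable_EFinP.
transitivity (\int[pushforward P (X : T -> measurableTypeR R)]_x (f x)%:E)%E.
  rewrite (@ge0_integral_pushforward _ _ T (measurableTypeR R))// => x _.
  by rewrite lee_fin.
transitivity (\int[normal_prob mean (Num.sqrt v)]_x (f x)%:E)%E.
  by apply: eq_measure_integral => A mA _; exact: gX.
rewrite (@ge0_integral_density _ _ _ (normal_prob mean (Num.sqrt v)) lebesgue_measure
  (fun x => (normal_pdf mean (Num.sqrt v) x)%:E))//.
by apply/measurable_EFinP; exact: measurable_normal_pdf.
Qed.

(** The mean vanishes by symmetry: the positive and negative parts of [X] are images
of one another under reflection, which preserves the centred normal law. *)
Lemma gaussian_centered_moments (X : T -> R) (v : R) :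
  measurable_fun [set: T] X -> 0 < v -> gaussian P X 0 v ->
  [/\ X \in L2, dot X (cst 1) = 0 & dot X X = v].
Proof.
move=> mX v0 gX; have s0 : 0 < Num.sqrt v by rewrite sqrtr_gt0.
have sqX : (\int[P]_w (X w ^+ 2)%:E = v%:E)%E.
  have msq : measurable_fun [set: R] (fun x : R => x ^+ 2) by exact: measurable_funX.
  rewrite (gaussian_ge0_integral mX gX msq) => [|x]; last exact: sqr_ge0.
  by rewrite integral_sqr_normal_pdf// sqr_sqrtr// ltW.
have hX : X \in L2 by apply: L2_sqr_lty => //; rewrite sqX ltry.
split=> //; last first.
  apply: EFin_inj; rewrite -dotL2_expectation// -sqX unlock.
  by apply: eq_integral => w _; rewrite expr2.
pose f x : R := Num.max x 0.
have cf : continuous f by move=> x; apply: continuous_max; [exact: cvg_id | exact: cvg_cst].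
have f0 x : 0 <= f x by rewrite /f le_max lexx orbT.
have mf : measurable_fun [set: R] f by exact: continuous_measurable_fun.
have reflect : (\int[P]_w (f (X w))%:E = \int[P]_w (f (- X w))%:E)%E.
  have mfN : measurable_fun [set: R] (fun x => f (- x)) by exact: measurableT_comp.
  rewrite (gaussian_ge0_integral mX gX mf)// (gaussian_ge0_integral mX gX mfN)//.
  rewrite (ge0_integral_reflection (f := fun x => (f x * normal_pdf 0 (Num.sqrt v) x)%:E)).
  - apply: eq_integral => x _; congr (_ * _)%:E.
    by rewrite !normal_pdfE ?gt_eqF// /normal_fun !subr0 sqrrN.
  - apply/measurable_EFinP; apply: measurable_funM => //.
    exact: measurable_normal_pdf.
  - by move=> x; rewrite lee_fin mulr_ge0// normal_pdf_ge0.
apply: EFin_inj; rewrite -dotL2_expectation//; last exact: L2_cst.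
rewrite unlock; under eq_integral do rewrite mulr1.
have iX : P.-integrable [set: T] (EFin \o X).
  apply/Lfun1_integrable; apply: Lfun_subset12 => //.
  exact: fin_num_measure.
rewrite integralE.
have fE : (\int[P]_w (f (X w))%:E = \int[P]_w (fun w => (X w)%:E)^\+ w)%E.
  by apply: eq_integral => w _; rewrite unlock /f EFin_max.
have fN : (\int[P]_w (f (- X w))%:E = \int[P]_w (fun w => (X w)%:E)^\- w)%E.
  by apply: eq_integral => w _; rewrite unlock /f EFin_max.
rewrite -fE -fN -reflect subee// fE.
exact: integrable_pos_fin_num.
Qed.

(** The law of [(X, Y)] and the product of the laws agree on rectangles, hence
everywhere, and Fubini applies to [(x, y) |-> x y]. *)
Lemma dotL2_independent (X Y : T -> R) : X \in L2 -> Y \in L2 ->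
  (forall A B : set R, measurable A -> measurable B ->
    P (X @^-1` A `&` Y @^-1` B) = (P (X @^-1` A) * P (Y @^-1` B))%E) ->
  dot X Y = dot X (cst 1) * dot Y (cst 1).
Proof.
move=> hX hY indep.
pose Xm : {mfun T >-> R} := mfun_Sub (mem_set (L2_measurable hX)).
pose Ym : {mfun T >-> R} := mfun_Sub (mem_set (L2_measurable hY)).
have mZ : measurable_fun [set: T] (fun w => (Xm w, Ym w)) by exact/measurable_fun_pair.
pose Zm : {mfun T >-> (R * R)%type} := mfun_Sub (mem_set mZ).
pose f (z : R * R) := (z.1 * z.2)%:E.
have mf : measurable_fun [set: R * R] f.
  by apply/measurable_EFinP; apply: measurable_funM.
have iXY : P.-integrable [set: T] (f \o Zm).
  by apply/Lfun1_integrable; exact: L2_mul_L1 hX hY.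
have lawE A : measurable A ->
    (distribution P Xm \x distribution P Ym)%E A = distribution P Zm A.
  move=> mA; exact: product_measure_unique.
have fE (g : R * R -> \bar R) :
    (\int[distribution P Xm \x distribution P Ym]_z g z =
     \int[distribution P Zm]_z g z)%E.
  by apply: eq_measure_integral => A mA _; exact: lawE.
have if_ : (distribution P Xm \x distribution P Ym)%E.-integrable [set: R * R] f.
  apply/integrableP; split => //; rewrite fE ge0_integral_distribution//.
    by have /integrableP[] := iXY.
  exact: measurableT_comp.
have L1 (U : T -> R) : U \in L2 -> P.-integrable [set: T] (EFin \o U).
  move=> hU; apply/Lfun1_integrable; apply: Lfun_subset12 => //.
  exact: fin_num_measure.
have id_int (U : {mfun T >-> R}) : (U : T -> R) \in L2 ->
    (distribution P U).-integrable [set: R] EFin.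
  by move=> hU; apply: integrable_pushforward => //; exact: L1.
have mean (U : {mfun T >-> R}) : (U : T -> R) \in L2 ->
    (\int[distribution P U]_x x%:E = (dot U (cst 1))%:E)%E.
  move=> hU; rewrite integral_distribution//; last exact: L1.
  rewrite -dotL2_expectation ?L2_cst// unlock.
  by apply: eq_integral => w _; rewrite mulr1.
apply: EFin_inj; rewrite -dotL2_expectation// unlock.
transitivity (\int[distribution P Zm]_z f z)%E.
  by rewrite integral_distribution.
rewrite -fE -integral12_prod_meas1// /fubini_F /f /=.
under eq_integral do under eq_integral do rewrite EFinM.
under eq_integral do rewrite integralZl ?id_int// mean//.
by rewrite integralZr ?id_int// mean.
Qed.

End gaussian.

(** * Brownian increments *)

Section brownian.
Context {d : measure_display} {T : measurableType d} {R : realType}.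
Variable P : probability T R.
Variable B : R -> {RV P >-> R}.
Hypothesis hB : brownian_motion B.
Local Notation L2 := (Lfun P 2%:E).
Local Notation dot := (dotL2 P).

Definition increment (s t : R) : T -> R := fun w => B t w - B s w.

Lemma increment_split s t u : increment s u = increment s t + increment t u.
Proof. by apply/funext => w; rewrite /increment !fctE; ring. Qed.

(** At [s = t] the increment vanishes identically, a degenerate law that the Gaussian
clause of Brownian motion leaves aside. *)
Lemma increment_moments s t : 0 <= s -> s <= t ->
  [/\ increment s t \in L2, dot (increment s t) (cst 1) = 0 &
      dot (increment s t) (increment s t) = t - s].
Proof.
move=> s0; rewrite le_eqVlt => /predU1P[<-|st].
  have -> : increment s s = cst 0 by apply/funext => w; rewrite /increment subrr.
  by rewrite !dotL2_0l subrr L2_cst.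
apply: gaussian_centered_moments; last exact: brownian_gaussian hB _ _ s0 st.
  exact: measurable_funB.
by rewrite subr_gt0.
Qed.

Lemma increment_L2 s t : 0 <= s -> s <= t -> increment s t \in L2.
Proof. by move=> s0 st; have [] := increment_moments s0 st. Qed.

Lemma increment_centered s t : 0 <= s -> s <= t -> dot (increment s t) (cst 1) = 0.
Proof. by move=> s0 st; have [] := increment_moments s0 st. Qed.

Lemma increment_sqr s t : 0 <= s -> s <= t ->
  dot (increment s t) (increment s t) = t - s.
Proof. by move=> s0 st; have [] := increment_moments s0 st. Qed.

(** The four times form a chain of three consecutive increments; the middle one is
left unconstrained in the product rule. *)
Lemma increment_orthogonal s t u v : 0 <= s -> s <= t -> t <= u -> u <= v ->
  dot (increment s t) (increment u v) = 0.
Proof.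
move=> s0 st tu uv; have u0 : 0 <= u by rewrite (le_trans s0)// (le_trans st).
rewrite dotL2_independent ?increment_L2// ?increment_centered ?mul0r//.
move=> U V mU mV.
(* The default values of [nth] are the last time [v] and the last set [V]. *)
pose tau := nth v [:: s; t; u].
have tau_nd i : (i < 3)%N -> tau i <= tau i.+1 by case: i => [|[|[|]]].
pose A (i : 'I_3) := nth V [:: U; setT] i.
have mA i : measurable (A i).
  by rewrite /A; case: i => -[|[|[|//]]] ? /=.
have := brownian_indep hB s0 tau_nd mA.
rewrite !big_ord_recl big_ord0 /= mule1.
rewrite preimage_setT probability_setT mul1e => <-.
congr (P _); apply/seteqP; split => [w [Uw Vw] i _|w].
  by case: i => -[|[|[|//]]] hi; [exact: Uw | | exact: Vw].
move=> Aw; split; first exact: (Aw ord0 I).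
exact: (Aw (lift ord0 (lift ord0 ord0)) I).
Qed.

(** An increment is measurable for the sigma-algebra generated by the Brownian
motion, as a difference of two of its generating variables. *)
Lemma increment_orthogonal_initial (Y0 : T -> R) s t : Y0 \in L2 ->
  independent_of_process P Y0 B -> 0 <= s -> s <= t ->
  dot Y0 (increment s t) = 0.
Proof.
move=> hY indep s0 st; have t0 : 0 <= t by exact: le_trans st.
rewrite dotL2_independent ?increment_L2// ?increment_centered ?mulr0//.
move=> U V mU mV; apply: indep => //.
pose G := [set E : set T | exists (t : R) (A : set R),
         [/\ 0 <= t, measurable A & E = B t @^-1` A]].
have mB r : 0 <= r -> measurable_fun [set: g_sigma_algebraType G]
    (B r : g_sigma_algebraType G -> R).
  move=> r0 _ A mA; rewrite setTI; apply: sub_sigma_algebra.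
  by exists r, A.
have := measurable_funB (mB t t0) (mB s s0).
by move=> /(_ measurableT V mV); rewrite setTI.
Qed.

End brownian.

(** * The exponential scheme on a mesh *)

(** Evaluated along one path [b]; the random scheme is obtained by letting [b] and
[y0] depend on the sample point. *)
Fixpoint ou_scheme (R : realType) (theta sigma h y0 : R) (b : R -> R) (k : nat) : R :=
  if k is k'.+1 then
    expR (- theta * h) * (ou_scheme theta sigma h y0 b k' +
      sigma * (b (k'.+1%:R * h) - b (k'%:R * h)))
  else y0.

(** The error made on one step by replacing [exp(-x)] with [1 / (1 + x)]; it controls
both the drift of the variance and the local error of the scheme. *)
Lemma expRN_Euler_defect (R : realType) (x : R) : 0 <= x ->
  0 <= 1 - expR (- x) * (1 + x) <= x ^+ 2.
Proof.
move=> x0; apply/andP; split.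
  by rewrite subr_ge0 expRN mulrC ler_pdivrMr ?expR_gt0// mul1r expR_ge1Dx.
rewrite lerBlDl -lerBlDr (_ : 1 - x ^+ 2 = (1 - x) * (1 + x)); last by ring.
by rewrite ler_wpM2r ?addr_ge0// expR_ge1Dx.
Qed.

Section scheme.
Context {d : measure_display} {T : measurableType d} {R : realType}.
Variable P : probability T R.
Local Notation L2 := (Lfun P 2%:E).
Local Notation dot := (dotL2 P).
Variables (theta sigma : R) (B : R -> {RV P >-> R}) (Y0 : T -> R).
Hypothesis theta_gt0 : 0 < theta.
Hypothesis hB : brownian_motion B.
Hypothesis hY0 : Y0 \in L2.
Hypothesis Y0_centered : dot Y0 (cst 1) = 0.
Hypothesis Y0_sqr : dot Y0 Y0 = sigma ^+ 2 / (2 * theta).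
Hypothesis Y0_orthogonal : forall s t, 0 <= s -> s <= t -> dot Y0 (increment B s t) = 0.

Local Notation q h := (expR (- theta * h)).
Let X (h : R) (k : nat) : T -> R :=
  fun w => ou_scheme theta sigma h (Y0 w) (fun t => B t w) k.
Let dB (h : R) (k : nat) : T -> R := increment B (k%:R * h) (k.+1%:R * h).

Let XS h k : X h k.+1 = q h *: (X h k + sigma *: dB h k).
Proof. by []. Qed.

Let time_ge0 (h : R) (k : nat) : 0 <= h -> 0 <= k%:R * h.
Proof. by move=> h0; rewrite mulr_ge0. Qed.

Let time_le (h : R) (k l : nat) : 0 <= h -> (k <= l)%N -> k%:R * h <= l%:R * h.
Proof. by move=> h0 kl; rewrite ler_wpM2r// ler_nat. Qed.

Let dB_L2 h k : 0 <= h -> dB h k \in L2.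
Proof. by move=> h0; apply: (increment_L2 hB); [exact: time_ge0 | exact: time_le]. Qed.

Lemma scheme_L2 h k : 0 <= h -> X h k \in L2.
Proof.
move=> h0; elim: k => [//|k IH]; rewrite XS.
by apply/L2Z/L2D => //; exact/L2Z/dB_L2.
Qed.
Local Hint Resolve scheme_L2 dB_L2 : core.

Lemma scheme_centered h k : 0 <= h -> dot (X h k) (cst 1) = 0.
Proof.
move=> h0; elim: k => [//|k IH]; rewrite XS.
have h1 := L2_cst P 1; have hZ : sigma *: dB h k \in L2 by apply: L2Z; exact: dB_L2.
have hX := scheme_L2 k h0; have hd := dB_L2 k h0.
have hs : X h k + sigma *: dB h k \in L2 by exact: L2D.
rewrite dotL2Zl// dotL2Dl// IH dotL2Zl//.
rewrite (increment_centered hB); [by rewrite mulr0 addr0 mulr0| |].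
  exact: time_ge0.
exact: time_le.
Qed.

(** The scheme at step [k] is built from [Y0] and increments up to time [k h], all
orthogonal to what happens later. *)
Lemma scheme_orthogonal h k u v : 0 <= h -> k%:R * h <= u -> u <= v ->
  dot (X h k) (increment B u v) = 0.
Proof.
move=> h0; elim: k => [|k IH] ku uv.
  by rewrite Y0_orthogonal//; rewrite mul0r in ku.
have ku' : k%:R * h <= u by apply: le_trans ku; exact: time_le.
have u0 : 0 <= u by apply: le_trans ku; exact: time_ge0.
have hI : increment B u v \in L2 by exact: (increment_L2 hB).
have hZ : sigma *: dB h k \in L2 by apply: L2Z; exact: dB_L2.
have hX := scheme_L2 k h0; have hd := dB_L2 k h0.
have hs : X h k + sigma *: dB h k \in L2 by exact: L2D.
rewrite XS dotL2Zl// dotL2Dl// IH// dotL2Zl// (increment_orthogonal hB)//.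
- by rewrite mulr0 addr0 mulr0.
- exact: time_ge0.
- exact: time_le.
Qed.

Let dB_sqr h k : 0 <= h -> dot (dB h k) (dB h k) = h.
Proof.
move=> h0; rewrite (increment_sqr hB); [| exact: time_ge0| exact: time_le].
by rewrite -mulrBl -natrB// subSnn mul1r.
Qed.

Lemma scheme_sqrS h k : 0 <= h ->
  dot (X h k.+1) (X h k.+1) = q h ^+ 2 * (dot (X h k) (X h k) + sigma ^+ 2 * h).
Proof.
move=> h0; have hX := scheme_L2 k h0; have hd := dB_L2 k h0.
have hZ : sigma *: dB h k \in L2 by exact: L2Z.
have hs : X h k + sigma *: dB h k \in L2 by exact: L2D.
have hqs : q h *: (X h k + sigma *: dB h k) \in L2 by exact: L2Z.
rewrite XS dotL2Zl// dotL2Zr// dotL2_sqrD// !dotL2Zr// dotL2Zl//.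
rewrite scheme_orthogonal//; last exact: time_le.
by rewrite dB_sqr//; ring.
Qed.

(** With [v] the stationary variance and [x = 2 theta h], the recursion reads
[V_(k+1) = exp(-x) (V_k + v x)]; [v] is a fixed point up to
[v (1 - exp(-x) (1 + x)) <= v x^2], and the map is a contraction. *)
Lemma scheme_variance h k : 0 <= h ->
  `|dot (X h k) (X h k) - sigma ^+ 2 / (2 * theta)| <=
  k%:R * (sigma ^+ 2 / (2 * theta) * (2 * theta * h) ^+ 2).
Proof.
move=> h0; set v := sigma ^+ 2 / (2 * theta); set x := 2 * theta * h.
have v0 : 0 <= v by rewrite divr_ge0 ?sqr_ge0 ?mulr_ge0// ltW.
have x0 : 0 <= x by rewrite !mulr_ge0// ltW.
have vx : sigma ^+ 2 * h = v * x by rewrite /v /x; field; rewrite gt_eqF.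
have qx : q h ^+ 2 = expR (- x) by rewrite -expRM_natl /x; congr expR; ring.
have q0 : 0 <= expR (- x) by exact: expR_ge0.
have q1 : expR (- x) <= 1 by rewrite -expR0 ler_expR oppr_le0.
have /andP[defect_ge0 defect_le] := expRN_Euler_defect x0.
elim: k => [|k IH]; first by rewrite /X /= Y0_sqr subrr normr0 mul0r.
rewrite scheme_sqrS// qx vx.
set V := dot (X h k) (X h k) in IH *.
rewrite (_ : _ - v = expR (- x) * (V - v) - v * (1 - expR (- x) * (1 + x))); last by ring.
apply: le_trans (ler_normB _ _) _; rewrite -natr1 mulrDl mul1r; apply: lerD.
  apply: le_trans IH; rewrite normrM (ger0_norm q0).
  by rewrite ler_piMl.
rewrite ger0_norm; last exact: mulr_ge0.
by rewrite ler_wpM2l.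
Qed.

(** Each further step multiplies by [exp(-theta h)] and adds noise orthogonal to the
past. *)
Lemma scheme_covariance h k j : 0 <= h ->
  dot (X h k) (X h (k + j)) = q h ^+ j * dot (X h k) (X h k).
Proof.
move=> h0; elim: j => [|j IH]; first by rewrite addn0 mul1r.
have hX := scheme_L2 k h0; have hXj := scheme_L2 (k + j) h0; have hd := dB_L2 (k + j) h0.
have hZ : sigma *: dB h (k + j) \in L2 by exact: L2Z.
have hs : X h (k + j) + sigma *: dB h (k + j) \in L2 by exact: L2D.
rewrite addnS XS dotL2Zr// dotL2Dr// dotL2Zr// IH scheme_orthogonal//.
- by rewrite exprS; ring.
- by apply: time_le => //; exact: leq_addr.
- exact: time_le.
Qed.

Let increment_sum h p n : increment B (p%:R * h) ((p + n)%:R * h) =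
  \sum_(l < n) dB h (p + l).
Proof.
elim: n => [|n IH].
  by rewrite big_ord0 addn0; apply/funext => w; rewrite /increment subrr.
by rewrite big_ord_recr/= -IH addnS -increment_split.
Qed.

Let scheme_multistep h p j : X h (p + j) =
  q h ^+ j *: X h p + sigma *: \sum_(l < j) (q h ^+ (j - l) *: dB h (p + l)).
Proof.
elim: j => [|j IH]; first by rewrite addn0 big_ord0 scaler0 addr0 scale1r.
rewrite addnS XS IH big_ord_recr/= subSnn.
rewrite (_ : \sum_(l < j) q h ^+ (j.+1 - l) *: dB h (p + l) =
   q h *: \sum_(l < j) q h ^+ (j - l) *: dB h (p + l)); last first.
  rewrite scaler_sumr; apply: eq_bigr => l _.
  by rewrite subSn ?exprS ?scalerA// ltnW.
rewrite !scalerDr !scalerA exprS expr1 -!addrA; congr (_ + (_ + _)).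
  by rewrite mulrC.
by rewrite mulrC.
Qed.

Let dB_comb_sqr h p (c : nat -> R) n : 0 <= h ->
  dot (\sum_(l < n) c l *: dB h (p + l)) (\sum_(l < n) c l *: dB h (p + l)) =
  \sum_(l < n) c l ^+ 2 * h.
Proof.
move=> h0; have hF l : c l *: dB h (p + l) \in L2 by exact/L2Z/dB_L2.
elim: n => [|n IH]; first by rewrite !big_ord0; exact: dotL2_0l.
have hS : \sum_(l < n) c l *: dB h (p + l) \in L2.
  exact: (L2_sum n (F := fun l => c l *: dB h (p + l))).
have hn := dB_L2 (p + n) h0.
have orth : dot (\sum_(l < n) c l *: dB h (p + l)) (c n *: dB h (p + n)) = 0.
  rewrite dotL2C (dotL2_sumr n (F := fun l => c l *: dB h (p + l)))// big1// => l _.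
  have hl := dB_L2 (p + l) h0.
  rewrite dotL2Zl// dotL2Zr// dotL2C (increment_orthogonal hB) ?mulr0//.
  - exact: time_ge0.
  - exact: time_le.
  - by apply: time_le => //; rewrite ltn_add2l.
  - exact: time_le.
rewrite !big_ord_recr/= dotL2_sqrD// IH orth dotL2Zl// dotL2Zr// dB_sqr//.
by ring.
Qed.

(** Over one coarse cell the fine scheme weighs the increments of the sub-cells by
different powers of [exp(-theta h/m)], the coarse one by the same factor; the
weights differ by at most [theta h].  The resulting noise is orthogonal to the
discrepancy accumulated so far, so that squared norms add up, each cell
contributing at most [sigma^2 (theta h)^2 h].  The bound is independent of [m]. *)
Lemma scheme_refinement h m k : 0 <= h ->
  let D := X (h / m.+1%:R) (k * m.+1) - X h k in
  dot D D <= k%:R * (sigma ^+ 2 * theta ^+ 2 * h ^+ 3).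
Proof.
move=> h0; set h' := h / m.+1%:R; set M := m.+1.
have h'0 : 0 <= h' by rewrite divr_ge0.
have Mh (j : nat) : (j * M)%:R * h' = j%:R * h.
  by rewrite /h' natrM -mulrA [h / _]mulrC (mulVKf _ h) ?pnatr_eq0.
have qM : q h' ^+ M = q h.
  by rewrite -expRM_natl; congr expR; rewrite mulrCA -[M]mul1n Mh mul1r.
have qh1 : q h' <= 1 by rewrite -expR0 ler_expR mulNr oppr_le0 mulr_ge0// ltW.
have theta_h0 : 0 <= theta * h by rewrite mulr_ge0// ltW.
elim: k => [|k IH] /=.
  rewrite mul0r (_ : X h' (0 * M) - X h 0 = cst 0) ?dotL2_0l//.
  by apply/funext => w; rewrite /X /= !fctE subrr.
move: IH; set D := X h' (k * M) - X h k => /= IH.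
pose c l := q h' ^+ (M - l) - q h.
pose S := \sum_(l < M) c l *: dB h' (k * M + l).
have DE : X h' (k.+1 * M) - X h k.+1 = q h *: D + sigma *: S.
  rewrite mulSnr scheme_multistep qM XS /dB -Mh -(Mh k.+1) mulSnr increment_sum.
  rewrite (_ : S = \sum_(l < M) q h' ^+ (M - l) *: dB h' (k * M + l) -
       q h *: \sum_(l < M) dB h' (k * M + l)); last first.
    rewrite scaler_sumr -sumrB; apply: eq_bigr => l _.
    by rewrite scalerBl.
  set S1 := \sum_(l < M) q h' ^+ (M - l) *: _; set S2 := \sum_(l < M) dB _ _.
  rewrite /D; move: (X h' _) (X h k) S1 S2 => X1 X2 S1 S2.
  apply/funext => w; rewrite !fctE /GRing.scale /=; ring.
have hF l : c l *: dB h' (k * M + l) \in L2 by exact/L2Z/dB_L2.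
have hX' := scheme_L2 (k * M) h'0; have hX := scheme_L2 k h0.
have hD : D \in L2 by exact: L2B.
have hS : S \in L2 by exact: (L2_sum M (F := fun l => c l *: dB h' (k * M + l))).
have DS : dot D S = 0.
  rewrite (dotL2_sumr M (F := fun l => c l *: dB h' (k * M + l)))// big1// => l _.
  have hd := dB_L2 (k * M + l) h'0.
  have after : (k * M)%:R * h' <= (k * M + l)%:R * h'.
    by apply: time_le => //; exact: leq_addr.
  have step : (k * M + l)%:R * h' <= (k * M + l).+1%:R * h' by exact: time_le.
  rewrite dotL2Zr// dotL2Bl// !scheme_orthogonal ?subrr ?mulr0//.
  by rewrite -Mh.
have hqD : q h *: D \in L2 by exact: L2Z.
have hsS : sigma *: S \in L2 by exact: L2Z.
rewrite DE dotL2_sqrD// !dotL2Zr// !dotL2Zl// DS dB_comb_sqr//.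
rewrite !mulr0 addr0 -natr1 mulrDl mul1r; apply: lerD.
  apply: le_trans IH; rewrite mulrA -expr2 ler_piMl ?dotL2_ge0//.
  by rewrite expr_le1// ?expR_ge0// -qM exprn_ile1// expR_ge0.
rewrite mulrA -expr2.
rewrite -[X in _ <= X]mulrA ler_wpM2l ?sqr_ge0//.
apply: (@le_trans _ _ (\sum_(l < M) (theta * h) ^+ 2 * h')).
  apply: ler_sum => l _; rewrite ler_wpM2r//.
  have c0 : 0 <= c l.
    by rewrite subr_ge0 -qM ler_wiXn2l ?expR_ge0// leq_subr.
  rewrite lerXn2r ?nnegrE//.
  rewrite /c lerBlDl; apply: (@le_trans _ _ 1); first by rewrite exprn_ile1 ?expR_ge0.
  by rewrite -lerBlDr -mulNr; exact: expR_ge1Dx.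
rewrite sumr_const card_ord -mulr_natl mulrCA -[M in M%:R]mul1n Mh mul1r.
by rewrite le_eqVlt; apply/orP; left; apply/eqP; ring.
Qed.

End scheme.

(** * Pathwise convergence of the scheme *)

(** Heine's theorem, by a covering argument on [A]. *)
Lemma within_continuous_uniform (R : realType) (A : set R) (f : R -> R) (eps : R) :
  compact A -> {within A, continuous f} -> 0 < eps ->
  exists2 delta, 0 < delta &
    forall s t, A s -> A t -> `|s - t| < delta -> `|f s - f t| <= eps.
Proof.
move=> cA /subspace_continuousP cf e0.
have e2 : 0 < eps / 2 by rewrite divr_gt0.
pose Q (delta t : R) := A t -> forall s, A s -> `|s - t| < delta -> `|f s - f t| <= eps.
have : \forall delta \near (0 : R)^'+, A `<=` Q delta.
  have /compact_near_coveringP := cA; apply => x Ax.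
  have := cf x Ax; move=> /cvgrPdist_le/(_ _ e2); rewrite near_withinE.
  move=> /nbhs_ballP[r /= r0 xr].
  have r2 : 0 < r / 2 by rewrite divr_gt0.
  exists (ball x (r / 2), [set u : R | u < r / 2]).
    split=> /=; first exact: nbhsx_ballx.
    exact: nbhs_right_lt.
  move=> [t u] /= [xt ur] At s As st.
  have := xr t; have := xr s; rewrite -!ball_normE /= in xt * => hs ht.
  have xs : `|x - s| < r.
    rewrite (_ : x - s = (x - t) - (s - t)); last by ring.
    by rewrite (le_lt_trans (ler_normB _ _))// (splitr r) ltrD// (lt_trans st).
  have xt' : `|x - t| < r by rewrite (lt_trans xt)// ltr_pdivrMr// ltr_pMr// ltr1n.
  rewrite (_ : f s - f t = (f x - f t) - (f x - f s)); last by ring.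
  by rewrite (le_trans (ler_normB _ _))// (splitr eps) lerD//; [exact: ht | exact: hs].
move=> h; near (0 : R)^'+ => delta; exists delta; first by near: delta; exact: nbhs_right_gt.
have AQ : A `<=` Q delta by near: delta; exact: h.
by move=> s t As At; apply: AQ.
Unshelve. all: end_near. Qed.

Section pathwise.
Context {R : realType}.
Variables (theta sigma : R) (f b : R -> R).
Hypothesis theta_gt0 : 0 < theta.
Hypothesis f_cont : {within `[0, +oo[, continuous f}.
Hypothesis f_eq : forall t : R, 0 <= t ->
  f t = f 0 + (\int[lebesgue_measure]_(s in `[0, t]) (- theta * f s))
        + sigma * (b t - b 0).

Let f_contS (u v : R) : 0 <= u -> {within `[u, v], continuous f}.
Proof.
move=> u0; apply: continuous_subspaceW f_cont => x /=.
by rewrite !in_itv/= andbT => /andP[ux _]; exact: le_trans ux.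
Qed.

Let f_int (u v : R) : 0 <= u -> lebesgue_measure.-integrable `[u, v] (EFin \o f).
Proof.
move=> u0; apply: continuous_compact_integrable; first exact: segment_compact.
exact: f_contS.
Qed.

Lemma sde_step (u v : R) : 0 <= u -> u <= v ->
  f v = f u - theta * (\int[lebesgue_measure]_(s in `[u, v]) f s) + sigma * (b v - b u).
Proof.
move=> u0 uv; have v0 : 0 <= v by exact: le_trans uv.
rewrite (f_eq v0) (f_eq u0) !RintegralZl//; [|exact: f_int..].
have := @Rintegral_itvB R f (BLeft 0) (BRight v) u (f_int v (lexx 0)).
rewrite !bnd_simp => /(_ u0 uv).
rewrite Rintegral_itv_obnd_cbnd => [<-|]; first by ring.
apply: integrableS (f_int v u0) => // x /=.
by rewrite !in_itv/= => /andP[/ltW -> ->].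
Qed.

(** Eliminating the Brownian increment with the integral equation, the one-step error
becomes [(1 - q (1 + x)) f(v) + q theta ((v - u) f(v) - I)], where
[x = theta (v - u)], [q = exp(-x)] and [I] is the integral of [f] over [[u, v]]. *)
Lemma scheme_local_error (u v eps M : R) : 0 <= u -> u <= v ->
  `|f v| <= M -> (forall s, u <= s <= v -> `|f v - f s| <= eps) ->
  `|f v - expR (- theta * (v - u)) * (f u + sigma * (b v - b u))| <=
    (theta * (v - u)) ^+ 2 * M + theta * (v - u) * eps.
Proof.
move=> u0 uv fM fe; set h := v - u; set q := expR _.
have h0 : 0 <= h by rewrite subr_ge0.
have x0 : 0 <= theta * h by rewrite mulr_ge0// ltW.
set I := \int[lebesgue_measure]_(s in `[u, v]) f s.
have muE : fine (lebesgue_measure `[u, v]) = h.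
  rewrite lebesgue_measure_itv/= lte_fin /h; move: uv; rewrite le_eqVlt.
  by move=> /predU1P[->|->] //; rewrite ltxx subrr.
have int_cst (c : R) : lebesgue_measure.-integrable `[u, v] (EFin \o cst c).
  apply: continuous_compact_integrable; first exact: segment_compact.
  by apply: continuous_subspaceT => x; exact: cst_continuous.
have int_diff : lebesgue_measure.-integrable `[u, v] (EFin \o (fun s => f v - f s)).
  exact: (integrableB _ (int_cst (f v)) (f_int v u0)).
have dI : `|h * f v - I| <= h * eps.
  have -> : h * f v - I = \int[lebesgue_measure]_(s in `[u, v]) (f v - f s).
    rewrite (RintegralB _ (int_cst (f v)) (f_int v u0))//.
    by rewrite Rintegral_cst// muE mulrC.
  apply: le_trans (le_normr_Rintegral _ int_diff) _ => //.
  rewrite -muE mulrC -Rintegral_cst//.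
  apply: (le_Rintegral _ (integrable_abse int_diff) (int_cst eps)) => //.
have fE : f u + sigma * (b v - b u) = f v + theta * I.
  by rewrite (sde_step u0 uv) -/I; ring.
have qE : q = expR (- (theta * h)) by rewrite /q mulNr.
have q0 : 0 <= q by exact: expR_ge0.
have q1 : q <= 1 by rewrite qE -expR0 ler_expR oppr_le0.
have /andP[d0 d1] := expRN_Euler_defect x0; rewrite -qE in d0 d1.
rewrite fE (_ : _ - _ = (1 - q * (1 + theta * h)) * f v +
    q * (theta * (h * f v - I))); last by ring.
apply: le_trans (ler_normD _ _) _; rewrite !normrM; apply: lerD.
  by rewrite (ger0_norm d0) ler_pM.
rewrite (ger0_norm q0) (gtr0_norm theta_gt0) -mulrA.
apply: le_trans (_ : theta * `|h * f v - I| <= _).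
  by rewrite ler_piMl// mulr_ge0// ltW.
by rewrite ler_wpM2l// ltW.
Qed.

(** Local errors are propagated by factors at most [1], so they add up over the
[j n] steps to [O(1/n)] plus the modulus of continuity of [f] at scale
[delta / n]. *)
Lemma scheme_pathwise_cvg (delta : R) (j : nat) : 0 < delta ->
  ou_scheme theta sigma (delta / n.+1%:R) (f 0) b (j * n.+1) @[n --> \oo]
  --> f (j%:R * delta).
Proof.
move=> delta0; set S := j%:R * delta.
have S0 : 0 <= S by rewrite mulr_ge0// ltW.
have [M fM] : exists M, forall s, 0 <= s <= S -> `|f s| <= M.
  have [c _ fc] := EVT_max S0 (@f_contS 0 S (lexx 0)).
  have [c' _ fc'] := EVT_min S0 (@f_contS 0 S (lexx 0)).
  exists (`|f c| + `|f c'|) => s sS.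
  rewrite ler_norml; apply/andP; split.
    rewrite (le_trans _ (fc' s _)) ?in_itv//= lerNl.
    by rewrite (le_trans (ler_norm _))// normrN lerDr.
  by rewrite (le_trans (fc s _)) ?in_itv//= (le_trans (ler_norm _))// lerDl.
have M0 : 0 <= M by rewrite (le_trans _ (fM 0 _))// lexx.
have error n eps : (0 < n)%N -> (forall s t, 0 <= s <= S -> 0 <= t <= S ->
      `|s - t| <= delta / n%:R -> `|f s - f t| <= eps) ->
    `|f S - ou_scheme theta sigma (delta / n%:R) (f 0) b (j * n)| <=
    S * theta ^+ 2 * delta * M / n%:R + S * theta * eps.
  move=> n0 fe; set h := delta / n%:R.
  have nn0 : n%:R != 0 :> R by rewrite pnatr_eq0 -lt0n.
  have h0 : 0 <= h by rewrite divr_ge0// ltW.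
  have hS : (j * n)%:R * h = S by rewrite /h /S natrM; field.
  have step k : (k <= j * n)%N ->
      `|f (k%:R * h) - ou_scheme theta sigma h (f 0) b k| <=
      k%:R * ((theta * h) ^+ 2 * M + theta * h * eps).
    elim: k => [_|k IH kj]; first by rewrite /= !mul0r subrr normr0.
    have kh0 : 0 <= k%:R * h by rewrite mulr_ge0.
    have kk : k%:R * h <= k.+1%:R * h by rewrite ler_wpM2r// ler_nat.
    have kS : k.+1%:R * h <= S by rewrite -hS ler_wpM2r// ler_nat.
    have hk : k.+1%:R * h - k%:R * h = h by rewrite -mulrBl -natrB// subSnn mul1r.
    have loc := @scheme_local_error _ _ eps M kh0 kk.
    rewrite hk in loc.
    have {}loc : `|f (k.+1%:R * h) - expR (- theta * h) *
        (f (k%:R * h) + sigma * (b (k.+1%:R * h) - b (k%:R * h)))| <=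
        (theta * h) ^+ 2 * M + theta * h * eps.
      apply: loc; first by apply: fM; rewrite kS (le_trans kh0).
      move=> s /andP[ks sk]; apply: fe.
      - by rewrite kS (le_trans kh0).
      - by rewrite (le_trans kh0 ks) (le_trans sk).
      - by rewrite ger0_norm ?subr_ge0// -/h -[X in _ <= X]hk lerB.
    rewrite /=; set Y := ou_scheme _ _ _ _ _ _ in IH *.
    set dB := sigma * _ in loc *; set q := expR _ in loc *.
    have q0 : 0 <= q by exact: expR_ge0.
    have q1 : q <= 1 by rewrite /q -expR0 ler_expR mulNr oppr_le0 mulr_ge0// ltW.
    rewrite (_ : _ - _ = q * (f (k%:R * h) - Y) +
       (f (k.+1%:R * h) - q * (f (k%:R * h) + dB))); last by ring.
    apply: le_trans (ler_normD _ _) _.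
    rewrite -[k.+1%:R in X in _ <= X]natr1 mulrDl mul1r; apply: lerD; last exact: loc.
    apply: le_trans (IH (ltnW kj)); rewrite normrM (ger0_norm q0).
    by rewrite ler_piMl.
  have := step _ (leqnn _); rewrite hS => /le_trans; apply.
  rewrite le_eqVlt; apply/orP; left; apply/eqP.
  rewrite [LHS](_ : _ = ((j * n)%:R * h) * (theta ^+ 2 * h * M + theta * eps)); last by ring.
  by rewrite hS /h; field.
apply/cvgrPdist_le => e e0.
have c0 : 0 < 2 * (S * theta + 1) by rewrite mulr_gt0// ltr_wpDl// mulr_ge0// ltW.
have eps0 : 0 < e / (2 * (S * theta + 1)) by rewrite divr_gt0.
have [r r0 fr] := within_continuous_uniform (@segment_compact R 0 S)
  (@f_contS 0 S (lexx 0)) eps0.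
near=> n.
have n1 : delta / n.+1%:R < r.
  rewrite ltr_pdivrMr// mulrC -ltr_pdivrMr//; apply: (@lt_trans _ _ n%:R).
    by near: n; exact: nbhs_infty_gtr.
  by rewrite ltr_nat.
have n2 : S * theta ^+ 2 * delta * M / n.+1%:R <= e / 2.
  rewrite ler_pdivrMr// [e / 2 * _]mulrC -ler_pdivrMr ?divr_gt0//; apply: (@le_trans _ _ n%:R).
    by apply: ltW; near: n; exact: nbhs_infty_gtr.
  by rewrite ler_nat.
apply: le_trans (error n.+1 (e / (2 * (S * theta + 1))) isT _) _.
  by move=> s t s0 t0 st; apply: fr; rewrite /= ?in_itv//=; exact: le_lt_trans n1.
rewrite [X in _ <= X](splitr e) lerD//.
rewrite mulrA ler_pdivrMr// (_ : e / 2 * _ = (S * theta + 1) * e); last by field.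
by rewrite ler_wpM2r ?(ltW e0)// lerDl.
Unshelve. all: end_near. Qed.

End pathwise.

(** * Second moments of the stationary Ornstein-Uhlenbeck process *)

Section covariance.
Context {d : measure_display} {T : measurableType d} {R : realType}.
Variable P : probability T R.
Local Notation L2 := (Lfun P 2%:E).
Local Notation dot := (dotL2 P).
Variables (theta sigma : R) (B Y : R -> {RV P >-> R}).
Hypotheses (theta_gt0 : 0 < theta) (sigma_gt0 : 0 < sigma).
Hypothesis hY : stationary_ou theta sigma B Y.
Local Notation v := (sigma ^+ 2 / (2 * theta)).

Let hB := ou_noise hY.

Let v_gt0 : 0 < v.
Proof. by rewrite divr_gt0 ?exprn_gt0// mulr_gt0. Qed.

Let Y0_moments : [/\ (Y 0 : T -> R) \in L2, dot (Y 0) (cst 1) = 0 & dot (Y 0) (Y 0) = v].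
Proof. by apply: gaussian_centered_moments => //; exact: ou_init hY. Qed.

Let Y0_orthogonal s t : 0 <= s -> s <= t -> dot (Y 0) (increment B s t) = 0.
Proof.
have [hY0 _ _] := Y0_moments.
exact: (increment_orthogonal_initial hB hY0 (ou_init_indep hY)).
Qed.

Let X (h : R) (k : nat) : T -> R :=
  fun w => ou_scheme theta sigma h (Y 0 w) (fun t => B t w) k.

Let X_L2 h k : 0 <= h -> X h k \in L2.
Proof. by have [hY0 _ _] := Y0_moments; exact: scheme_L2. Qed.

Let X_cvg (h : R) (j : nat) : 0 < h ->
  {ae P, forall w, X (h / n.+1%:R) (j * n.+1) w @[n --> \oo] --> Y (j%:R * h) w}.
Proof.
move=> h0; apply: filterS (ou_equation hY) => w [cw ew].
exact: (scheme_pathwise_cvg (b := fun t => B t w) theta_gt0 cw ew).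
Qed.

(** Refinements of the mesh converge to [Y] almost surely while staying within the
refinement bound of the scheme of mesh [h]. *)
Let X_error (h : R) (j : nat) : 0 < h ->
  (Y (j%:R * h) : T -> R) \in L2 /\
  dot ((Y (j%:R * h) : T -> R) - X h j) ((Y (j%:R * h) : T -> R) - X h j) <=
    j%:R * (sigma ^+ 2 * theta ^+ 2 * h ^+ 3).
Proof.
move=> h0; have hX := X_L2 j (ltW h0).
have [hY0 Y0c Y0v] := Y0_moments.
have [] := @L2_fatou _ _ _ P (fun m => X (h / m.+1%:R) (j * m.+1) - X h j)
  ((Y (j%:R * h) : T -> R) - X h j) (j%:R * (sigma ^+ 2 * theta ^+ 2 * h ^+ 3)).
- by move=> m; apply: L2B => //; apply: X_L2; rewrite divr_ge0// ltW.
- apply: measurable_funB => //; exact: L2_measurable hX.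
- apply: filterS (X_cvg j h0) => w cw.
  by apply: cvgB; [exact: cw | exact: cvg_cst].
- by move=> m; exact: (scheme_refinement sigma theta_gt0 hB hY0 Y0_orthogonal m j (ltW h0)).
move=> hYX le; split=> //.
by rewrite -[(Y _ : T -> R)](subrK (X h j)); exact: L2D.
Qed.

Let cvg_div_nat (c : R) : c / n.+1%:R @[n --> \oo] --> 0.
Proof.
rewrite -[X in _ --> X](mulr0 c); apply: cvgM; first exact: cvg_cst.
exact: cvg_harmonic.
Qed.

Variable delta : R.
Hypothesis delta_gt0 : 0 < delta.

Let h n : R := delta / n.+1%:R.

Let succ_neq0 n : n.+1%:R != 0 :> R. Proof. by rewrite pnatr_eq0. Qed.

Let h_gt0 n : 0 < h n. Proof. by rewrite divr_gt0. Qed.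

Let time_h j n : (j * n.+1)%:R * h n = j%:R * delta.
Proof. by rewrite /h natrM; move: (n.+1%:R) (succ_neq0 n) => N N0; field. Qed.

Let X_L2_cvg (j : nat) :
  dot ((Y (j%:R * delta) : T -> R) - X (h n) (j * n.+1))
      ((Y (j%:R * delta) : T -> R) - X (h n) (j * n.+1)) @[n --> \oo] --> 0.
Proof.
apply: (@cvg_bounded_dist _ _ (fun n =>
  (j%:R * (sigma ^+ 2 * theta ^+ 2 * delta ^+ 3)) / n.+1%:R)) => [n|]; last exact: cvg_div_nat.
have [_] := X_error (j * n.+1) (h_gt0 n).
rewrite time_h subr0 ger0_norm ?dotL2_ge0// => /le_trans; apply.
rewrite (_ : _ * _ = j%:R * (sigma ^+ 2 * theta ^+ 2 * delta ^+ 3) / n.+1%:R / n.+1%:R).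
  rewrite ler_pdivrMr// ler_peMr ?ler1n// divr_ge0//.
  by rewrite !mulr_ge0// ?exprn_ge0// ltW.
by rewrite /h natrM; move: (n.+1%:R) (succ_neq0 n) => N N0; field.
Qed.

Lemma stationary_ou_L2 (j : nat) : (Y (j%:R * delta) : T -> R) \in L2.
Proof. by have [] := X_error j delta_gt0. Qed.

Lemma stationary_ou_centered (j : nat) : dot (Y (j%:R * delta)) (cst 1) = 0.
Proof.
have [hY0 Y0c Y0v] := Y0_moments.
have : dot (X (h n) (j * n.+1)) (cst 1) @[n --> \oo] --> dot (Y (j%:R * delta)) (cst 1).
  apply: dotL2_cvg.
  - by move=> n; apply: X_L2; exact: ltW.
  - by move=> n; exact: L2_cst.
  - exact: stationary_ou_L2.
  - exact: L2_cst.
  - exact: X_L2_cvg.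
  - by rewrite subrr; under eq_fun do rewrite (dotL2_0l P); exact: cvg_cst.
under eq_fun do rewrite (scheme_centered theta sigma hB hY0 Y0c _ (ltW (h_gt0 _))).
by move=> /(cvg_unique _ (cvg_cst 0))->.
Qed.

(** Limit along the meshes [delta / n], for which the sampling times are mesh points. *)
Lemma stationary_ou_covariance (j k : nat) :
  dot (Y (j%:R * delta)) (Y ((j + k)%:R * delta)) = v * expR (- theta * delta) ^+ k.
Proof.
have [hY0 Y0c Y0v] := Y0_moments.
have cYY : dot (X (h n) (j * n.+1)) (X (h n) ((j + k) * n.+1)) @[n --> \oo] -->
    dot (Y (j%:R * delta)) (Y ((j + k)%:R * delta)).
  apply: dotL2_cvg; [| | exact: stationary_ou_L2.. | exact: X_L2_cvg | exact: X_L2_cvg];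
    by move=> n; apply: X_L2; exact: ltW.
have qE n : expR (- theta * h n) ^+ (k * n.+1) = expR (- theta * delta) ^+ k.
  by rewrite -!expRM_natl mulrCA time_h mulrCA.
have varE : dot (X (h n) (j * n.+1)) (X (h n) (j * n.+1)) @[n --> \oo] --> v.
  apply: (@cvg_bounded_dist _ _ (fun n =>
    (j%:R * (v * (2 * theta * delta) ^+ 2)) / n.+1%:R)) => [n|]; last exact: cvg_div_nat.
  apply: le_trans (scheme_variance theta_gt0 hB hY0 Y0v Y0_orthogonal _ (ltW (h_gt0 n))) _.
  rewrite le_eqVlt; apply/orP; left; apply/eqP.
  by rewrite /h natrM; move: (n.+1%:R) (succ_neq0 n) => N N0; field; rewrite N0 gt_eqF.
have XE n : dot (X (h n) (j * n.+1)) (X (h n) ((j + k) * n.+1)) =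
    dot (X (h n) (j * n.+1)) (X (h n) (j * n.+1)) * expR (- theta * delta) ^+ k.
  rewrite mulnDl (scheme_covariance theta sigma hB hY0 Y0_orthogonal _ _ (ltW (h_gt0 _))).
  by rewrite qE mulrC.
move: cYY; under eq_fun do rewrite XE; move=> cYY.
apply: (cvg_unique _ cYY) => //.
by apply: cvgM => //; exact: cvg_cst.
Qed.

End covariance.

(** * The exponential moving average *)

Fixpoint ema (R : realType) (alpha : R) (x : nat -> R) (k : nat) : R :=
  if k is k'.+1 then (1 - alpha) * ema alpha x k' + alpha * x k else x 0%N.

Section bias.
Context {R : realType}.
Variables (alpha : R).
Hypothesis alpha01 : 0 < alpha <= 1.
Local Notation beta := (1 - alpha).

Let alpha_neq0 : alpha != 0. Proof. by case/andP: alpha01 => a0 _; rewrite gt_eqF. Qed.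

Lemma ema_biasS (x : nat -> R) k :
  ema alpha x k.+1 - x k.+1 = beta * (ema alpha x k - x k) - beta * (x k.+1 - x k).
Proof. by rewrite /=; ring. Qed.

Lemma ema_bias_le (x : nat -> R) (L : R) k :
  (forall i, (i < k)%N -> `|x i.+1 - x i| <= L) ->
  `|ema alpha x k - x k| <= L * (beta * (1 - beta ^+ k) / alpha).
Proof.
case/andP: alpha01 => a0 a1; have b0 : 0 <= beta by rewrite subr_ge0.
elim: k => [|k IH] xL; first by rewrite /= subrr normr0 expr0 subrr mulr0 mul0r mulr0.
rewrite ema_biasS; apply: le_trans (ler_normB _ _) _; rewrite !normrM (ger0_norm b0).
rewrite (_ : L * _ = beta * (L * (beta * (1 - beta ^+ k) / alpha)) + beta * L); last first.
  by rewrite exprS; field.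
apply: lerD; rewrite ler_wpM2l//; last exact: xL.
by apply: IH => i ik; apply: xL; exact: ltnW.
Qed.

Lemma ema_bias_linear (x : nat -> R) (c : R) k :
  (forall i, (i < k)%N -> x i.+1 - x i = c) ->
  ema alpha x k - x k = - c * (beta * (1 - beta ^+ k) / alpha).
Proof.
elim: k => [|k IH] xc; first by rewrite /= subrr expr0 subrr mulr0 mul0r mulr0.
rewrite ema_biasS xc// IH => [|i ik]; last by apply: xc; exact: ltnW.
by rewrite exprS; field.
Qed.

Lemma emaD (x y : nat -> R) k :
  ema alpha (fun i => x i + y i) k = ema alpha x k + ema alpha y k.
Proof. by elim: k => [//|k IH] /=; rewrite IH; ring. Qed.

End bias.

Section noise.
Context {d : measure_display} {T : measurableType d} {R : realType}.
Variable P : probability T R.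
Local Notation L2 := (Lfun P 2%:E).
Local Notation dot := (dotL2 P).
Variables (alpha rho v : R) (U : nat -> T -> R).
Local Notation beta := (1 - alpha).
Hypothesis alpha01 : 0 < alpha <= 1.
Hypothesis rho1 : rho < 1.
Hypothesis beta_rho : beta != rho.
Hypothesis hU : forall k, U k \in L2.
Hypothesis U_centered : forall k, dot (U k) (cst 1) = 0.
Hypothesis U_cov : forall j k, dot (U j) (U (j + k)%N) = v * rho ^+ k.

Let Z k : T -> R := fun w => ema alpha (fun i => U i w) k.

Let ZS k : Z k.+1 = beta *: Z k + alpha *: U k.+1.
Proof. by []. Qed.

Lemma ema_L2 k : Z k \in L2.
Proof. by elim: k => [|k IH]; [exact: hU | rewrite ZS; apply: L2_lin => //; exact: L2Z]. Qed.

Lemma ema_centered k : dot (Z k) (cst 1) = 0.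
Proof.
elim: k => [|k IH]; first exact: U_centered.
have hZ := ema_L2 k; have h1 := L2_cst P 1; have haU : alpha *: U k.+1 \in L2 by exact: L2Z.
by rewrite ZS dotL2_linl// IH dotL2Zl// U_centered !mulr0 addr0.
Qed.

Let beta_ge0 : 0 <= beta. Proof. by case/andP: alpha01; rewrite subr_ge0. Qed.
Let beta_lt1 : beta < 1. Proof. by case/andP: alpha01 => a0 _; rewrite ltrBlDr ltrDl. Qed.
Let beta_rho_lt1 : beta * rho < 1.
Proof. by rewrite (le_lt_trans _ beta_lt1)// ler_piMr// ltW. Qed.
Let beta_rho_neq1 : 1 - beta * rho != 0.
Proof. by rewrite subr_eq0 eq_sym lt_eqF. Qed.
Let beta2_neq1 : 1 - beta ^+ 2 != 0.
Proof. by rewrite subr_eq0 eq_sym lt_eqF// expr_lt1. Qed.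
Let beta_sub_rho : beta - rho != 0. Proof. by rewrite subr_eq0. Qed.

(** [beta * transient] is what [1] exceeds [alpha / (1 - beta rho)] by; with the factor
[beta] kept outside, [ema_variance] involves no division by [beta]. *)
Let transient : R := (1 - rho) / (1 - beta * rho).

(** The covariance with a future value decays by [rho] per step, so that
[d_k = dot (Z k) (U k)] satisfies [d_(k+1) = beta rho d_k + alpha v], whose
fixed point is [v alpha / (1 - beta rho)]. *)
Lemma ema_covariance k j : dot (Z k) (U (k + j)) =
  v * rho ^+ j * (alpha / (1 - beta * rho) + beta * transient * (beta * rho) ^+ k).
Proof.
elim: k j => [|k IH] j.
  by rewrite add0n -(add0n j) U_cov add0n expr0 /transient; field.
have hZ := ema_L2 k; have haU : alpha *: U k.+1 \in L2 by exact: L2Z.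
rewrite ZS dotL2_linl// dotL2Zl// U_cov addSnnS IH !exprS /transient.
by field.
Qed.

(** Solution of [V_(k+1) = beta^2 V_k + 2 alpha beta rho d_k + alpha^2 v], with [d_k]
given by [ema_covariance]: the constant part of [d_k] feeds a geometric sum of
ratio [beta^2], its transient part a convolution of the ratios [beta^2] and
[beta rho]. *)
Lemma ema_variance k : dot (Z k) (Z k) =
  beta ^+ (2 * k) * v
  + alpha ^+ 2 * v * ((1 + beta * rho) / (1 - beta * rho)) *
      ((1 - beta ^+ (2 * k)) / (1 - beta ^+ 2))
  + 2 * alpha * v * beta * rho * transient *
      ((beta ^+ (2 * k) - (beta * rho) ^+ k) / (beta - rho)).
Proof.
elim: k => [|k IH].
  rewrite muln0 !expr0 !subrr !mul0r !mulr0 !addr0 mul1r.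
  by have := U_cov 0 0; rewrite addn0 expr0 mulr1.
have hZ := ema_L2 k; have haU : alpha *: U k.+1 \in L2 by exact: L2Z.
have hbZ : beta *: Z k \in L2 by exact: L2Z.
rewrite ZS dotL2_sqrD// !dotL2Zr// !dotL2Zl// IH -[k.+1]addn1 ema_covariance.
have := U_cov (k + 1) 0; rewrite addn0 => ->.
rewrite addn1 mulnS exprD !exprS expr0 !mulr1 /transient exprMn.
move: (beta ^+ (2 * k)) (beta ^+ k) (rho ^+ k) => p q r.
field.
by rewrite beta_sub_rho beta_rho_neq1 -expr2.
Qed.

End noise.

(** * The mean squared error *)

(** Here [p = beta^(N-1)], [q = exp(-theta/N)] and [r = q^(N-1)]: the terms in [K]
on the left are the expanded square of the extremal bias. *)
Lemma risk_closed_form (R : fieldType) (K n v beta q p r : R) :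
  n != 0 -> q != 0 -> 1 - beta != 0 -> 1 - beta ^+ 2 != 0 ->
  1 - beta * q != 0 -> beta - q != 0 ->
  p ^+ 2 * v +
  (beta ^+ 2 * ((1 + beta) / (1 - beta)) * (K ^+ 2 / n ^+ 2) +
   (1 - beta) ^+ 2 * v * ((q^-1 + beta) / (q^-1 - beta))) *
  ((1 - p ^+ 2) / (1 - beta ^+ 2)) +
  2 * (K ^+ 2 / n ^+ 2) *
  ((p ^+ 2 * beta ^+ 2 - p * beta ^+ 2) / (1 - beta) ^+ 2) +
  (1 - beta) * (2 * v) * ((q^-1 - 1) / (1 - beta * q)) *
  ((p ^+ 2 * beta ^+ 1 * q - beta * p * (q * r)) / (beta / q - 1)) =
  p ^+ 2 * v +
  (1 - beta) ^+ 2 * v * ((1 + beta * q) / (1 - beta * q)) *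
  ((1 - p ^+ 2) / (1 - beta ^+ 2)) +
  2 * (1 - beta) * v * beta * q * ((1 - q) / (1 - beta * q)) *
  ((p ^+ 2 - p * r) / (beta - q)) +
  (K / n * (beta * (1 - p) / (1 - beta))) ^+ 2.
Proof.
move=> n0 q0 b0 b1 bq bmq.
by field; do ![apply/andP; split].
Qed.

Theorem theorem1p1 (d : measure_display) (T : measurableType d) (R : realType)
  (P : probability T R) (theta sigma K : R)
  (htheta : 0 < theta) (hsigma : 0 < sigma) (hK : 0 < K)
  (m : R -> R)
  (hm : forall t s : R, 0 <= t <= 1 -> 0 <= s <= 1 ->
     `|m t - m s| <= K * `|t - s|)
  (B Y : R -> {RV P >-> R}) (hY : stationary_ou theta sigma B Y)
  (X : R -> T -> R)
  (hX : forall (t : R) (w : T), 0 <= t <= 1 -> X t w = m t + Y t w)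
  (N : nat) (hN : (1 <= N)%N)
  (alpha beta : R) (halpha : 0 < alpha <= 1) (hbeta : beta = 1 - alpha)
  (mhat : nat -> T -> R)
  (hmhat1 : forall w : T, mhat 1%N w = X (1 / N%:R) w)
  (hmhat : forall (t : nat) (w : T), (2 <= t <= N)%N ->
     mhat t w = (1 - alpha) * mhat t.-1 w + alpha * X (t%:R / N%:R) w) :
  let mstar (t : nat) : R := m (t%:R / N%:R) in
  let bound : R :=
    beta ^+ (2 * (N - 1)) * (sigma ^+ 2 / (2 * theta))
    + (beta ^+ 2 * ((1 + beta) / (1 - beta)) * (K ^+ 2 / N%:R ^+ 2)
       + alpha ^+ 2 * (sigma ^+ 2 / (2 * theta))
         * ((expR (theta / N%:R) + beta) / (expR (theta / N%:R) - beta)))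
      * ((1 - beta ^+ (2 * (N - 1))) / (1 - beta ^+ 2))
    + 2 * (K ^+ 2 / N%:R ^+ 2)
      * ((beta ^+ (2 * N) - beta ^+ (N + 1)) / alpha ^+ 2)
    + alpha * (sigma ^+ 2 / theta)
      * ((expR (theta / N%:R) - 1) / (1 - beta * expR (- theta / N%:R)))
      * ((beta ^+ (2 * N - 1) * expR (- theta / N%:R)
          - beta ^+ N * expR (- theta))
         / (beta * expR (theta / N%:R) - 1)) in
  ('E_P[fun w => (`|mhat 1%N w - mstar 1%N| ^+ 2)%R])%E
    = (sigma ^+ 2 / (2 * theta))%:E /\
  ((2 <= N)%N -> beta <> expR (- theta / N%:R) ->
    ('E_P[fun w => (`|mhat N w - mstar N| ^+ 2)%R] <= bound%:E)%E /\
    (forall a b : R, `|b| = K ->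
      (forall t : R, 0 <= t <= 1 -> m t = a + b * t) ->
      ('E_P[fun w => (`|mhat N w - mstar N| ^+ 2)%R])%E = bound%:E)).
Proof.
move=> mstar bound.
have N0 : 0 < N%:R :> R by rewrite ltr0n.
have Nn0 : N%:R != 0 :> R by rewrite gt_eqF.
have d0 : 0 < N%:R^-1 :> R by rewrite invr_gt0.
pose v := sigma ^+ 2 / (2 * theta); pose rho := expR (- theta / N%:R).
(* Sampling starts at time 1: index [k] stands for time [k.+1]. *)
pose U k : T -> R := Y (k.+1%:R / N%:R).
have rho_gt0 : 0 < rho by exact: expR_gt0.
have rho_lt1 : rho < 1.
  by rewrite -expR0 ltr_expR mulNr oppr_lt0 divr_gt0.
have hU k : U k \in Lfun P 2%:E by exact: (stationary_ou_L2 htheta hsigma hY d0).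
have U_centered k : dotL2 P (U k) (cst 1) = 0.
  exact: (stationary_ou_centered htheta hsigma hY d0).
have U_cov j k : dotL2 P (U j) (U (j + k)%N) = v * rho ^+ k.
  by rewrite /U -addSn; exact: (stationary_ou_covariance htheta hsigma hY d0).
pose mu k := mstar k.+1.
pose Z k : T -> R := fun w => ema alpha (fun i => U i w) k.
have grid t : (t <= N)%N -> 0 <= (t%:R / N%:R : R) <= 1.
  by move=> tN; rewrite divr_ge0//= ler_pdivrMr// mul1r ler_nat.
have mhatE k w : (k < N)%N -> mhat k.+1 w - mu k = (ema alpha mu k - mu k) + Z k w.
  move=> kN; suff -> : mhat k.+1 w = ema alpha (fun i => mu i + U i w) k.
    by rewrite emaD /Z; ring.
  elim: k kN => [|k IH] kN; first by rewrite hmhat1 hX//; exact: (grid 1%N).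
  by rewrite hmhat ?kN//= IH 1?ltnW// hX//; exact: grid.
have hZ k : Z k \in Lfun P 2%:E by exact: ema_L2.
have Z_centered k : dotL2 P (Z k) (cst 1) = 0 by exact: ema_centered.
have risk k : (k < N)%N ->
    ('E_P[fun w => (`|mhat k.+1 w - mu k| ^+ 2)%R] =
     (dotL2 P (Z k) (Z k) + (ema alpha mu k - mu k) ^+ 2)%:E)%E.
  move=> kN; set D := ema alpha mu k - mu k.
  have h1 := L2_cst P 1; have hD : D *: cst 1 \in Lfun P 2%:E by exact: L2Z.
  rewrite (_ : (fun w => _) = (fun w => `|(D *: cst 1 + Z k) w| ^+ 2)); last first.
    by apply/funext => w; rewrite mhatE// !fctE /GRing.scale /= mulr1.
  rewrite expectation_sqr; last exact: L2D.
  have one : dotL2 P (cst 1) (cst 1) = 1.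
    rewrite /dotL2 (_ : (fun w => _) = cst 1) ?expectation_cst//.
    by apply/funext => w /=; rewrite mulr1.
  rewrite dotL2_sqrD// !dotL2Zl// dotL2Zr// one dotL2C Z_centered.
  by congr EFin; ring.
split.
  rewrite (risk 0%N hN) /= subrr expr0n addr0; congr EFin.
  by have := U_cov 0 0; rewrite addn0 expr0 mulr1.
move=> N2 beta_rho.
have [k Nk] : exists k, N = k.+1 by exists N.-1; rewrite prednK.
have alpha_neq0 : alpha != 0 by case/andP: halpha => a0 _; rewrite gt_eqF.
have beta_neq_rho : 1 - alpha != rho by rewrite -hbeta; exact/eqP.
pose s := beta * (1 - beta ^+ k) / alpha.
have boundE : bound = dotL2 P (Z k) (Z k) + (K / N%:R * s) ^+ 2.
  have b0 : 0 <= beta by rewrite hbeta subr_ge0; case/andP: halpha.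
  have b1 : beta < 1 by rewrite hbeta ltrBlDr ltrDl; case/andP: halpha.
  have br : beta * rho < 1 by rewrite (le_lt_trans _ b1)// ler_piMr// ltW.
  have expN : expR (- theta) = rho * rho ^+ k.
    by rewrite -exprS -Nk /rho -expRM_natl; congr expR; field.
  have expinv : expR (theta / N%:R) = rho^-1 by rewrite /rho mulNr expRN invrK.
  rewrite /bound expN expinv -/rho {}/s.
  rewrite (ema_variance halpha rho_lt1 beta_neq_rho hU U_cov) -hbeta -/v.
  have -> : sigma ^+ 2 / theta = 2 * v by rewrite /v; field; rewrite gt_eqF.
  have -> : (2 * (N - 1) = 2 * k)%N by rewrite Nk subn1.
  have -> : (2 * N = 2 * k + 2)%N by rewrite Nk mulnS addnC.
  have -> : (N + 1 = k + 2)%N by rewrite Nk addn1 addn2.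
  have -> : (2 * k + 2 - 1 = 2 * k + 1)%N by rewrite -addnBA.
  have -> : beta ^+ N = beta * beta ^+ k by rewrite Nk exprS.
  have -> : beta ^+ (2 * k) = (beta ^+ k) ^+ 2 by rewrite mulnC exprM.
  rewrite exprMn !(exprD beta (2 * k)) (exprD beta k).
  have -> : beta ^+ (2 * k) = (beta ^+ k) ^+ 2 by rewrite mulnC exprM.
  move: (beta ^+ k) (rho ^+ k) (N%:R : R) Nn0 => p r n n0.
  have -> : alpha = 1 - beta by rewrite hbeta; ring.
  apply: risk_closed_form => //.
  - by rewrite gt_eqF.
  - by rewrite subr_eq0 gt_eqF.
  - by rewrite subr_eq0 gt_eqF// expr_lt1.
  - by rewrite subr_eq0 gt_eqF.
  - by rewrite subr_eq0 hbeta.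
have -> : mhat N = mhat k.+1 by rewrite Nk.
have -> : mstar N = mu k by rewrite Nk.
have kN : (k < N)%N by rewrite Nk.
rewrite (risk k kN); split.
  rewrite lee_fin boundE lerD2l -[leLHS]real_normK ?num_real//.
  have step i : (i < k)%N -> `|mu i.+1 - mu i| <= K / N%:R.
    move=> ik; have i1 : (i.+1 <= N)%N by rewrite Nk ltnS ltnW.
    have i2 : (i.+2 <= N)%N by rewrite Nk.
    have := hm _ _ (grid _ i2) (grid _ i1).
    by rewrite -mulrBl -natrB// subSnn mul1r [ `|_^-1| ]ger0_norm ?(ltW d0).
  have := ema_bias_le halpha step; rewrite -hbeta -/s => le.
  rewrite ler_sqr ?nnegrE//; exact: le_trans le.
move=> a b bK m_lin; congr EFin; rewrite boundE; congr (_ + _).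
rewrite (@ema_bias_linear _ _ halpha mu (b / N%:R)) => [|i ik].
  by rewrite -hbeta -/s mulNr sqrrN !exprMn -bK real_normK ?num_real.
have i1 : (i.+1 <= N)%N by rewrite Nk ltnS ltnW.
have i2 : (i.+2 <= N)%N by rewrite Nk.
by rewrite /mu /mstar !m_lin ?grid// -natr1; ring.
Qed.
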